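(* The groups $A_4$, $Q_{12}$, $Q_{16}$, $G_{16,6}$, $G_{16,13}$, and every non-abelian group of order $n$ with $18 \leq n \leq 22$, have a directed $T_2$-terrace. No other non-abelian group of order at most $22$ has a directed $T_2$-terrace. Also, $\mathbb{Z}_6 \times \mathbb{Z}_3$ and $S_4$ have directed $T_2$-terraces. Finally, the only groups of order less than $20$ that have a directed $T_3$-terrace are the cyclic groups of order $p-1$ for $p$ prime.
   Context: Let $G$ be a finite group of order $n$ and $\mathbf{a}=(a_1,\dots,a_n)$ an arrangement of all elements of $G$. For $1\le m\le n-1$ define $\mathbf{b}^{(m)} = (b^{(m)}_1,\dots,b^{(m)}_{n-m})$ by $b^{(m)}_i = a_i^{-1}a_{i+m}$. For fixed $k \le n-1$, $\mathbf{a}$ is a directed $T_k$-terrace if for every $m \le k$ the entries of $\mathbf{b}^{(m)}$ are pairwise distinct. $Q_{4m}$ denotes the dicyclic group of order $4m$ (so $Q_{16}$ is the generalised quaternion group of order 16). $G_{16,6}$ and $G_{16,13}$ denote the groups with identifiers $(16,6)$ and $(16,13)$ in GAP's Small Groups Library, i.e. $G_{16,6} = \langle a,b : a^8 = b^2 = e,\ bab^{-1} = a^5\rangle$ (the modular group of order 16) and $G_{16,13} = \langle a,b,c : a^4=b^2=c^2=e,\ ab=ba,\ ac=ca,\ cbc^{-1} = a^2 b\rangle$ (the central product of $D_8$ and $\mathbb{Z}_4$). $\mathbb{Z}_n$ is the cyclic group of order $n$, $A_4$ and $S_4$ the alternating and symmetric groups on 4 letters. *)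

(* Defs.v *)
From mathcomp Require Import all_boot all_fingroup all_solvable.
Set Implicit Arguments.
Unset Strict Implicit.
Unset Printing Implicit Defensive.
Local Open Scope group_scope.

(* s = (a_1,...,a_n) is an arrangement of all elements of G, and for every
   1 <= m <= k the sequence b^(m)_i = a_i^-1 a_(i+m) (i = 1..n-m) has
   pairwise distinct entries.  Indices are 0-based here.  When m >= n the
   sequence b^(m) is empty, so the condition is vacuous. *)
Definition is_directed_terrace (gT : finGroupType) (G : {set gT}) (k : nat)
    (s : seq gT) : bool :=
  perm_eq s (enum G) &&
  [forall m : 'I_k.+1, (0 < (m : nat))%N ==>
     uniq [seq (nth 1 s i)^-1 * nth 1 s (i + m) | i <- iota 0 (size s - m)]].

Definition has_directed_terrace (gT : finGroupType) (k : nat) (G : {set gT}) : Prop :=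
  exists s : seq gT, is_directed_terrace G k s.

Definition isQ12 (gT : finGroupType) (G : {set gT}) : Prop :=
  G \isog Grp (a : b : (a ^+ 6, b ^+ 2 = a ^+ 3, a ^ b = a^-1)).

Definition isQ16 (gT : finGroupType) (G : {set gT}) : Prop :=
  G \isog Grp (a : b : (a ^+ 8, b ^+ 2 = a ^+ 4, a ^ b = a^-1)).

(* G_{16,6} = < a, b : a^8 = b^2 = e, b a b^-1 = a^5 >  (b = b^-1). *)
Definition isG16_6 (gT : finGroupType) (G : {set gT}) : Prop :=
  G \isog Grp (a : b : (a ^+ 8, b ^+ 2, a ^ b = a ^+ 5)).

Definition isG16_13 (gT : finGroupType) (G : {set gT}) : Prop :=
  G \isog Grp (a : b : c : (a ^+ 4, b ^+ 2, c ^+ 2, [~ a, b], [~ a, c],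
                            b ^ c = a ^+ 2 * b)).

Definition isZ6xZ3 (gT : finGroupType) (G : {set gT}) : Prop :=
  G \isog Grp (a : b : (a ^+ 6, b ^+ 3, [~ a, b])).

(* Main.v *)
From HB Require Import structures.
Require Import Defs.
From mathcomp Require Import all_boot all_fingroup all_solvable.
Set Implicit Arguments.
Unset Strict Implicit.
Unset Printing Implicit Defensive.

(** A group of order at most 22 is solvable, hence a cyclic extension of prime index of a
    smaller one, and is determined by an automorphism and a fixed element of that smaller
    group.  Running through all these data yields a complete list of multiplication tables
    up to isomorphism, and every assertion about small groups becomes one about finitely
    many tables.  Terraces are exhibited explicitly.  For non-existence, an abelian group
    in which the product of all elements is trivial has no directed T_1-terrace, because
    the product of the differences telescopes; the other groups are settled by a
    backtracking search over terraces that start with the identity, up to automorphisms. *)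

(** * Multiplication tables *)

(** Little of the machinery needs its own proof. Words in generators, candidate isomorphisms and
    invariants are heuristics whose output is checked afterwards by [table_iso] or
    [table_generated]. Only two lists must be exhaustive: the automorphisms in [autos], since a
    missing one could lose an extension, and the branches of the backtracking search. An isomorphism
    from a known table to the table of an extension is enough to transport a model, so the listed
    tables need not be verified as groups for the classification. They become groups only to pass
    from a presentation to a table, because two groups with the same presentation are isomorphic.
    The telescoping argument leaves the abelian groups with a unique involution, where the product
    of all the elements is that involution. Among them, the cyclic groups of order p - 1 with p
    prime have terraces given by discrete logarithms, and the others of order below 20 go to the
    search. *)

Definition table := seq (seq nat).

Definition mult (t : table) x y := nth 0 (nth [::] t x) y.

(** Row x lists the products x * j in the order of j, so the position of y in it is x^-1 * y. *)
Definition ldiv (t : table) x y := index y (nth [::] t x).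

Definition square_table (t : table) := all (fun r => size r == size t) t.

Definition cyc n : table := mkseq (fun i => mkseq (fun j => (i + j) %% n) n) n.

(* Index k * m + u stands for x ^+ k * u, where u runs over the m entries of t,
   x acts on them by conjugation as s, and x ^+ p = h. *)
Definition ext p (t : table) (s : seq nat) h : table :=
  let m := size t in
  mkseq (fun i => mkseq (fun j =>
    let w := mult t (iter (j %/ m) (nth 0 s) (i %% m)) (j %% m) in
    let k := i %/ m + j %/ m in
    if k < p then k * m + w else (k - p) * m + mult t h w) (p * m)) (p * m).

Local Open Scope group_scope.

(** Kept apart from [model] because f may fail to be injective: a homomorphism from a table into an
    arbitrary group satisfying its relations is what presentations require. *)
Record table_hom (gT : finGroupType) (t : table) (f : nat -> gT) : Prop := TableHom {
  table_hom1 : f 0 = 1;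
  table_homM : forall i j, i < size t -> j < size t ->
                 mult t i j < size t /\ f (mult t i j) = f i * f j }.

Record model (gT : finGroupType) (G : {set gT}) (t : table) (f : nat -> gT) : Prop :=
  Model {
    model_hom : table_hom t f;
    model_square : square_table t;
    model_inj : {in gtn (size t) &, injective f};
    model_im : forall x, x \in G <-> exists2 i, i < size t & f i = x }.

Definition modelled (gT : finGroupType) (G : {set gT}) t := exists f, model G t f.

Lemma size_ext p t s h : size (ext p t s h) = (p * size t)%N.
Proof. by rewrite size_mkseq. Qed.

Lemma square_mkseq n (F : nat -> nat -> nat) :
  square_table (mkseq (fun i => mkseq (F i) n) n).
Proof. by apply/allP=> r /mapP[i _ ->]; rewrite !size_mkseq. Qed.

(** Powers of x are collected on the left: x^k u x^l v = x^(k + l) u^(x^l) v. When k + l reaches p,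
    the carry x^p is replaced by h. *)
Lemma ext_hom (gT : finGroupType) (t : table) (f : nat -> gT) p s h x :
    table_hom t f -> h < size t -> {in gtn (size t), forall u, nth 0 s u < size t} ->
    {in gtn (size t), forall u, f (nth 0 s u) = f u ^ x} -> x ^+ p = f h -> 0 < p ->
  table_hom (ext p t s h) (fun i => x ^+ (i %/ size t) * f (i %% size t)).
Proof.
move=> [f1 fM] lt_h sP sJ xp p_gt0; set m := size t in fM lt_h sP sJ *.
have m_gt0 : 0 < m by case: (m) lt_h.
have iterP l u : u < m -> iter l (nth 0 s) u < m /\ f (iter l (nth 0 s) u) = f u ^ x ^+ l.
  elim: l => [|l IHl] ltu /=; first by rewrite conjg1.
  by have [lt_l El] := IHl ltu; split; [apply: sP | rewrite sJ // El -conjgM -expgSr].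
split=> [|i j]; first by rewrite div0n mod0n mul1g.
rewrite size_ext -/m => lti ltj.
have [lt_um lt_vm] : i %% m < m /\ j %% m < m by rewrite !ltn_mod.
have [lt_kp lt_lp] : i %/ m < p /\ j %/ m < p by rewrite !ltn_divLR.
have -> : mult (ext p t s h) i j =
    let w := mult t (iter (j %/ m) (nth 0 s) (i %% m)) (j %% m) in
    let k := (i %/ m + j %/ m)%N in
    if k < p then (k * m + w)%N else ((k - p) * m + mult t h w)%N.
  by rewrite {1}/mult !nth_mkseq.
rewrite /=.
set k := i %/ m in lt_kp *; set l := j %/ m in lt_lp *.
set u := i %% m in lt_um *; set v := j %% m in lt_vm *.
have [lt_i Ei] := iterP l u lt_um.
have [lt_w Ew] := fM _ _ lt_i lt_vm.
set w := mult t _ v in lt_w Ew *.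
have fE : x ^+ k * f u * (x ^+ l * f v) = x ^+ (k + l) * f w.
  by rewrite Ew Ei expgD conjgE !mulgA mulgK.
have idx_lt a b : a < p -> b < m -> (a * m + b < p * m)%N.
  by move=> lta ltb; rewrite -ltn_divLR // divnMDl // divn_small // addn0.
rewrite fE; case: ifP => [lt_kl | /negbT ge_kl].
  by rewrite idx_lt // divnMDl // divn_small // addn0 modnMDl modn_small.
have{} ge_kl : p <= k + l by rewrite leqNgt.
have [lt_hw Ehw] := fM _ _ lt_h lt_w.
rewrite idx_lt //; last by rewrite ltn_subLR // (ltn_trans _ (_ : k + p < p + p)) ?ltn_add2l ?ltn_add2r.
split=> //; rewrite divnMDl // (divn_small lt_hw) addn0 modnMDl modn_small //.
by rewrite Ehw -xp mulgA -expgD subnK.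
Qed.

Section Model.

Variables (gT : finGroupType) (G : {group gT}) (t : table) (f : nat -> gT).
Hypothesis mGf : model G t f.

Let f1 : f 0 = 1 := table_hom1 (model_hom mGf).
Let fM := table_homM (model_hom mGf).
Let inj_f := model_inj mGf.

Definition model_index (x : gT) := find (fun i => f i == x) (iota 0 (size t)).

Lemma mem_model i : i < size t -> f i \in G.
Proof. by move=> lti; apply/(model_im mGf); exists i. Qed.

Lemma model_indexP x : x \in G -> model_index x < size t /\ f (model_index x) = x.
Proof.
move=> /(model_im mGf)[i lti Ei]; rewrite /model_index.
have hx : has (fun i => f i == x) (iota 0 (size t)).
  by apply/hasP; exists i; rewrite ?mem_iota // Ei.
have ltx := hx; rewrite has_find size_iota in ltx; split=> //.
by apply/eqP; have := nth_find 0 hx; rewrite nth_iota.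
Qed.

Lemma model_size_gt0 : 0 < size t.
Proof. by have [] := model_indexP (group1 G); case: (size t). Qed.

Lemma model_enum : perm_eq [seq f i | i <- iota 0 (size t)] (enum G).
Proof.
apply: uniq_perm; rewrite ?enum_uniq //.
  rewrite map_inj_in_uniq ?iota_uniq // => i j.
  by rewrite !mem_iota /=; apply: inj_f.
move=> x; rewrite mem_enum; apply/mapP/idP => [[i]|/(model_im mGf)[i lti <-]].
  by rewrite mem_iota => lti ->; apply: mem_model.
by exists i; rewrite // mem_iota.
Qed.

Lemma model_card : #|G| = size t.
Proof. by rewrite cardE -(perm_size model_enum) size_map size_iota. Qed.

Lemma model_mult_lt i j : i < size t -> j < size t -> mult t i j < size t.
Proof. by move=> lti ltj; case: (fM lti ltj). Qed.

Lemma model_multE i j : i < size t -> j < size t -> f (mult t i j) = f i * f j.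
Proof. by move=> lti ltj; case: (fM lti ltj). Qed.

Lemma size_row i : i < size t -> size (nth [::] t i) = size t.
Proof. by move=> lti; apply/eqP/(allP (model_square mGf))/mem_nth. Qed.

Lemma ldivP i j : i < size t -> j < size t ->
  ldiv t i j < size t /\ f (ldiv t i j) = (f i)^-1 * f j.
Proof.
move=> lti ltj; have Gij : (f i)^-1 * f j \in G by rewrite groupM ?groupV ?mem_model.
have [ltk Ek] := model_indexP Gij; set k := model_index _ in ltk Ek.
have Ej : mult t i k = j.
  by apply: inj_f; rewrite ?inE ?model_mult_lt ?model_multE // Ek mulKVg.
have row_j : j \in nth [::] t i by rewrite -Ej mem_nth // size_row.
have lt_ij : ldiv t i j < size t by rewrite -[size t](size_row lti) index_mem.
split=> //; apply: (mulgI (f i)); rewrite mulKVg -model_multE //; congr f; exact: nth_index.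
Qed.

End Model.

(** * Terraces and isomorphisms read on tables *)

Definition diffs (t : table) m d s :=
  [seq ldiv t (nth 0 s i) (nth 0 s (i + m)) | i <- iota 0 (d - m)].

Definition table_terrace k (t : table) s :=
  perm_eq s (iota 0 (size t)) &&
  all (fun m => uniq (diffs t m (size s) s)) (iota 1 k).

Definition table_comm (t : table) :=
  let r := iota 0 (size t) in all (fun i => all (fun j => mult t i j == mult t j i) r) r.

Definition table_prod (t : table) := foldl (mult t) 0 (iota 0 (size t)).

(** The rows are bound outside the inner loop so that evaluation looks each of them up once.
    Distinct values below n make phi a permutation, so surjectivity need not be tested. *)
Definition table_iso (t1 t2 : table) (phi : seq nat) :=
  let n := size t1 in
  [&& square_table t1, size t2 == n, size phi == n, nth 0 phi 0 == 0,
      uniq phi, all (gtn n) phi &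
      all (fun i => let r1 := nth [::] t1 i in let r2 := nth [::] t2 (nth 0 phi i) in
             all (fun j => (nth 0 r1 j < n) &&
                           (nth 0 phi (nth 0 r1 j) == nth 0 r2 (nth 0 phi j)))
               (iota 0 n)) (iota 0 n)].

(** Only elements of G commute, not those of the whole type, so a permutation is decomposed into
    block swaps and membership in G is carried along. *)
Lemma perm_prod_abelian (gT : finGroupType) (G : {group gT}) (s1 s2 : seq gT) :
    abelian G -> all [in G] s1 -> perm_eq s1 s2 ->
  \prod_(x <- s1) x = \prod_(x <- s2) x.
Proof.
move=> cGG Gs1 eq_s; have prodG s : all [in G] s -> \prod_(x <- s) x \in G.
  by move=> /allP Gs; rewrite big_seq group_prod.
set c := \prod_(x <- s1) x.
suffices [_ ->] : all [in G] s2 /\ \prod_(x <- s2) x = c by [].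
have: all [in G] s1 /\ \prod_(x <- s1) x = c by [].
move: c => c; move: s1 s2 eq_s {Gs1}.
apply: (@catCA_perm_ind _ (fun s => all [in G] s /\ \prod_(x <- s) x = c)) => u v w.
rewrite !all_cat !big_cat /= => -[/and3P[Gu Gv Gw] <-]; rewrite Gu Gv Gw; split=> //.
by rewrite !mulgA (centsP cGG _ (prodG _ Gu) _ (prodG _ Gv)).
Qed.

(** The factor g cancels in (g a)^-1 (g b), so no difference changes. This is what allows a terrace
    to start with the identity. *)
Lemma terrace_translate (gT : finGroupType) (G : {group gT}) k s g :
  g \in G -> is_directed_terrace G k s -> is_directed_terrace G k (map (mulg g) s).
Proof.
move=> Gg /andP[perm_s /forallP Ds]; apply/andP; split.
  apply: perm_trans (perm_map _ perm_s) _; apply: uniq_perm; rewrite ?enum_uniq //.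
    by rewrite map_inj_uniq ?enum_uniq //; apply: mulgI.
  move=> x; rewrite mem_enum; apply/mapP/idP => [[y]|Gx].
    by rewrite mem_enum => Gy ->; rewrite groupM.
  by exists (g^-1 * x); rewrite ?mulKVg // mem_enum groupM ?groupV.
apply/forallP=> m; apply/implyP=> m_gt0; have := implyP (Ds m) m_gt0.
rewrite size_map; congr (is_true (uniq _)); apply/eq_in_map=> i.
rewrite mem_iota /= add0n ltn_subRL => lti.
by rewrite !(nth_map 1) ?invMg -?mulgA ?mulKg ?(leq_ltn_trans _ lti) ?leq_addl // addnC.
Qed.

Lemma terrace_le (gT : finGroupType) (G : {set gT}) k l :
  k <= l -> has_directed_terrace l G -> has_directed_terrace k G.
Proof.
move=> le_kl [s /andP[perm_s /forallP Ds]]; exists s; rewrite /is_directed_terrace perm_s.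
apply/forallP=> m; exact: Ds (widen_ord (le_kl : k.+1 <= l.+1) m).
Qed.

Section ModelTerrace.

Variables (gT : finGroupType) (G : {group gT}) (t : table) (f : nat -> gT).
Hypothesis mGf : model G t f.

Let f1 : f 0 = 1 := table_hom1 (model_hom mGf).
Let inj_f := model_inj mGf.

Lemma model_indexK i : i < size t -> model_index t f (f i) = i.
Proof.
move=> lti; have [ltk Ek] := model_indexP mGf (mem_model mGf lti).
exact: inj_f ltk lti Ek.
Qed.

Lemma all_model_index s : all [in G] s -> all (gtn (size t)) (map (model_index t f) s).
Proof.
move=> /allP Gs; rewrite all_map; apply/allP=> x /Gs Gx /=.
by case: (model_indexP mGf Gx).
Qed.

Lemma map_model_index s : all [in G] s -> map f (map (model_index t f) s) = s.
Proof.
move=> /allP Gs; rewrite -map_comp -[RHS]map_id; apply/eq_in_map=> x /Gs Gx /=.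
by case: (model_indexP mGf Gx).
Qed.

Lemma model_terrace k s : all (gtn (size t)) s ->
  is_directed_terrace G k (map f s) = table_terrace k t s.
Proof.
move=> /allP lts; have lt_nth i : i < size s -> nth 0 s i < size t.
  by move=> lti; apply/lts/mem_nth.
have Ediffs m : [seq (nth 1 (map f s) i)^-1 * nth 1 (map f s) (i + m)
                   | i <- iota 0 (size (map f s) - m)] = map f (diffs t m (size s) s).
  rewrite size_map -map_comp; apply/eq_in_map=> i; rewrite mem_iota /= add0n ltn_subRL addnC.
  move=> lti; have lti' := leq_ltn_trans (leq_addr m i) lti.
  by rewrite !(nth_map 0) //; case: (ldivP mGf (lt_nth _ lti') (lt_nth _ lti)).
have uniq_diffs m : uniq (map f (diffs t m (size s) s)) = uniq (diffs t m (size s) s).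
  have lt_diffs i : i \in diffs t m (size s) s -> i < size t.
    case/mapP=> j; rewrite mem_iota /= add0n ltn_subRL addnC => ltj ->.
    have ltj' := leq_ltn_trans (leq_addr m j) ltj.
    by case: (ldivP mGf (lt_nth _ ltj') (lt_nth _ ltj)).
  rewrite map_inj_in_uniq // => i j /lt_diffs lti /lt_diffs; exact: inj_f lti.
congr (_ && _).
  rewrite -(permPr (model_enum mGf)); apply/idP/idP; last exact: perm_map.
  move=> /(perm_map (model_index t f)); rewrite -!map_comp.
  have mapK u : {in u, forall i, i < size t} -> map (model_index t f \o f) u = u.
    by move=> ltu; rewrite -[RHS]map_id; apply/eq_in_map=> i /ltu /model_indexK.
  by rewrite !mapK // => i; rewrite mem_iota.
apply/forallP/allP => [Ds m | Ds m].
  rewrite mem_iota => /andP[m_gt0 lt_m].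
  by have := implyP (Ds (Ordinal lt_m)) m_gt0; rewrite Ediffs uniq_diffs.
by apply/implyP=> m_gt0; rewrite Ediffs uniq_diffs Ds // mem_iota m_gt0 /= add1n.
Qed.

Lemma has_terrace_of_table k s : table_terrace k t s -> has_directed_terrace k G.
Proof.
move=> ts; exists (map f s); rewrite model_terrace //.
by case/andP: ts => /perm_mem eq_s _; apply/allP=> i; rewrite eq_s mem_iota.
Qed.

Lemma normalised_terrace k :
  has_directed_terrace k G -> exists s, table_terrace k t (0 :: s).
Proof.
case=> s ts; have Gs : all [in G] s.
  by case/andP: (ts) => /perm_mem eq_s _; apply/allP=> x; rewrite eq_s mem_enum.
case: s => [|x s] in ts Gs *.
  case/andP: ts => /perm_mem/(_ 1); by rewrite mem_enum group1.
have Gx : x \in G by case/andP: Gs.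
have := terrace_translate (groupVr Gx) ts; rewrite /= mulVg => ts1.
have Gs1 : all [in G] (1 :: map (mulg x^-1) s).
  by case/andP: (ts1) => /perm_mem eq_s _; apply/allP=> y; rewrite eq_s mem_enum.
exists (map (model_index t f) (map (mulg x^-1) s)).
have -> : 0 :: map (model_index t f) (map (mulg x^-1) s)
          = map (model_index t f) (1 :: map (mulg x^-1) s).
  by rewrite /= -f1 model_indexK // (model_size_gt0 mGf).
by rewrite -model_terrace ?all_model_index // map_model_index.
Qed.

Lemma model_abelian : table_comm t = abelian G.
Proof.
apply/idP/centsP => [/allP cGG x /(model_im mGf)[i lti <-] y /(model_im mGf)[j ltj <-] | cGG].
  rewrite /commute -!(model_multE mGf) //; congr (f _); apply/eqP.
  have iotaP k : k < size t -> k \in iota 0 (size t) by rewrite mem_iota.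
  exact: (allP (cGG i (iotaP i lti)) j (iotaP j ltj)).
apply/allP=> i; rewrite mem_iota => lti; apply/allP=> j; rewrite mem_iota => ltj.
apply/eqP/inj_f; rewrite ?inE ?(model_mult_lt mGf) // !(model_multE mGf) //.
by apply: cGG; apply: (mem_model mGf).
Qed.

(* The differences of a terrace telescope to a quotient of distinct elements, but
   in an abelian group they multiply to the product of all the elements. *)
Lemma abelian_prod1_no_terrace k :
    0 < k -> table_comm t -> table_prod t = 0 -> 1 < size t ->
  ~ has_directed_terrace k G.
Proof.
rewrite model_abelian => k_gt0 cGG prod0 n_gt1 /(terrace_le k_gt0)[s /andP[perm_s /forallP Ds]].
have{Ds} /= uD := implyP (Ds ord_max) isT.
have sz_s : size s = size t by rewrite (perm_size perm_s) -cardE (model_card mGf).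
have us : uniq s by rewrite (perm_uniq perm_s) enum_uniq.
have nthG i : i < size s -> nth 1 s i \in G.
  by move=> lti; rewrite -mem_enum -(perm_mem perm_s) mem_nth.
set D := map _ _ in uD.
have GD x : x \in D -> x \in G^#.
  case/mapP=> i; rewrite mem_iota /= add0n ltn_subRL addnC => lti ->.
  have lti' := leq_ltn_trans (leq_addr 1 i) lti.
  rewrite !inE groupM ?groupV ?nthG // andbT -eq_mulVg1 nth_uniq //.
  by rewrite addn1 neq_ltn ltnSn.
have prodG : \prod_(x <- enum G) x = 1.
  rewrite -(perm_prod_abelian cGG _ (model_enum mGf)); last first.
    by apply/allP=> _ /mapP[i + ->]; rewrite mem_iota => lti; apply: (mem_model mGf).
  have prodE u a : a < size t -> {subset u <= gtn (size t)} ->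
      f (foldl (mult t) a u) = f a * \prod_(i <- u) f i.
    elim: u a => [|i u IHu] a lta ltu; first by rewrite big_nil mulg1.
    have lti : i < size t by apply: ltu; rewrite mem_head.
    rewrite big_cons mulgA -(model_multE mGf) // -IHu ?(model_mult_lt mGf) // => j uj.
    by apply: ltu; rewrite inE uj orbT.
  have := prodE (iota 0 (size t)) 0 (ltnW n_gt1); rewrite -/(table_prod t) prod0 f1 mul1g big_map.
  by move=> <- // i; rewrite mem_iota.
(* The n - 1 differences are distinct and different from 1, so together with 1 they exhaust G. *)
have prodD : \prod_(x <- D) x = 1.
  have uD1 : uniq (1 :: D) by rewrite /= uD andbT; apply/negP=> /GD; rewrite !inE eqxx.
  have sub : {subset 1 :: D <= enum G}.
    by move=> x; rewrite inE mem_enum => /predU1P[-> // | /GD/setD1P[]].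
  have GD1 : all [in G] (1 :: D) by apply/allP=> x /sub; rewrite mem_enum.
  have perm_D : perm_eq (1 :: D) (enum G).
    have [|_ eqD] := uniq_min_size uD1 sub; last by apply: uniq_perm; rewrite ?enum_uniq.
    by rewrite /= size_map size_iota -cardE (model_card mGf) sz_s subn1 prednK // ltnW.
  by have := perm_prod_abelian cGG GD1 perm_D; rewrite big_cons mul1g prodG.
(* Telescoping: with a trivial product of differences, the first and last entries would coincide. *)
have: nth 1 s 0 * \prod_(x <- D) x = nth 1 s (size s - 1).
  rewrite /D big_map; move: (size s - 1)%N => d.
  elim: d => [|d IHd]; first by rewrite big_nil mulg1.
  by rewrite -addn1 iotaD big_cat /= mulgA IHd big_seq1 mulKVg.
rewrite prodD mulg1.
apply/eqP; rewrite nth_uniq ?sz_s //; last by rewrite ltn_subLR // ltnW.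
  by rewrite neq_ltn subn_gt0 n_gt1.
exact: ltnW.
Qed.

Lemma model_iso t1 phi : table_iso t1 t phi -> model G t1 (f \o nth 0 phi).
Proof.
case/and5P=> sq1 /eqP sz_t /eqP sz_phi /eqP phi0 /and3P[uphi /allP ltphi /allP homphi].
have lt_phi i : i < size t1 -> nth 0 phi i < size t.
  by move=> lti; rewrite sz_t; apply/ltphi/mem_nth; rewrite sz_phi.
split=> //.
- split=> [|i j lti ltj] /=; first by rewrite phi0.
  have iotaP k : k < size t1 -> k \in iota 0 (size t1) by rewrite mem_iota.
  have /andP[lt_ij /eqP Eij] := allP (homphi i (iotaP i lti)) j (iotaP j ltj).
  by split=> //; rewrite /mult Eij -(model_multE mGf) ?lt_phi.
- move=> i j lti ltj /= /(inj_f (lt_phi _ lti) (lt_phi _ ltj)) /eqP.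
  by rewrite nth_uniq ?sz_phi // => /eqP.
move=> x; split=> [Gx | [i lti <-]]; last by apply: (mem_model mGf); apply: lt_phi.
have [ltk Ek] := model_indexP mGf Gx; set k := model_index _ _ _ in ltk Ek.
have phi_k : k \in phi.
  have sub : {subset phi <= iota 0 (size t1)} by move=> i /ltphi; rewrite mem_iota.
  have [|_ ->] := uniq_min_size uphi sub; first by rewrite size_iota sz_phi.
  by rewrite mem_iota -sz_t.
by exists (index k phi); rewrite -?sz_phi ?index_mem //= nth_index.
Qed.

Lemma model_morphism (rT : finGroupType) (f' : nat -> rT) : table_hom t f' ->
  exists phi : {morphism G >-> rT}, forall i, i < size t -> phi (f i) = f' i.
Proof.
move=> [_ f'M]; have morphG : {in G &, {morph f' \o model_index t f : x y / x * y}}.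
  move=> x y Gx Gy /=; have [ltx Ex] := model_indexP mGf Gx.
  have [lty Ey] := model_indexP mGf Gy; have [_ <-] := f'M _ _ ltx lty.
  congr f'; apply: inj_f; rewrite ?inE ?(model_multE mGf) ?Ex ?Ey //.
  - by case: (model_indexP mGf (groupM Gx Gy)).
  - exact: (model_mult_lt mGf).
  by case: (model_indexP mGf (groupM Gx Gy)).
by exists (Morphism morphG) => i lti /=; rewrite model_indexK.
Qed.

End ModelTerrace.

Local Close Scope group_scope.

(** * Exhaustive search *)

(* The search visits some 18 million nodes.  Elements are constructors of an
   enumerated type and arrays are flat records, so that an access is a single
   match: this keeps the search feasible for plain kernel conversion. *)
Inductive elt := e0 | e1 | e2 | e3 | e4 | e5 | e6 | e7 | e8 | e9 | e10 | e11 | e12 | e13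
  | e14 | e15 | e16 | e17.
Inductive vec (A : Type) := Vec (a0 a1 a2 a3 a4 a5 a6 a7 a8 a9 a10 a11 a12 a13 a14 a15
  a16 a17 : A).
Arguments Vec {A}.

Definition get A (v : vec A) (x : elt) : A :=
  let: Vec a0 a1 a2 a3 a4 a5 a6 a7 a8 a9 a10 a11 a12 a13 a14 a15 a16 a17 := v in
  match x with e0 => a0 | e1 => a1 | e2 => a2 | e3 => a3 | e4 => a4 | e5 => a5 | e6 =>
  a6 | e7 => a7 | e8 => a8 | e9 => a9 | e10 => a10 | e11 => a11 | e12 => a12 | e13 =>
  a13 | e14 => a14 | e15 => a15 | e16 => a16 | e17 => a17 end.

Definition clear (v : vec bool) (x : elt) : vec bool :=
  let: Vec a0 a1 a2 a3 a4 a5 a6 a7 a8 a9 a10 a11 a12 a13 a14 a15 a16 a17 := v in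
  match x with
  | e0 => Vec false a1 a2 a3 a4 a5 a6 a7 a8 a9 a10 a11 a12 a13 a14 a15 a16 a17
  | e1 => Vec a0 false a2 a3 a4 a5 a6 a7 a8 a9 a10 a11 a12 a13 a14 a15 a16 a17
  | e2 => Vec a0 a1 false a3 a4 a5 a6 a7 a8 a9 a10 a11 a12 a13 a14 a15 a16 a17
  | e3 => Vec a0 a1 a2 false a4 a5 a6 a7 a8 a9 a10 a11 a12 a13 a14 a15 a16 a17
  | e4 => Vec a0 a1 a2 a3 false a5 a6 a7 a8 a9 a10 a11 a12 a13 a14 a15 a16 a17
  | e5 => Vec a0 a1 a2 a3 a4 false a6 a7 a8 a9 a10 a11 a12 a13 a14 a15 a16 a17
  | e6 => Vec a0 a1 a2 a3 a4 a5 false a7 a8 a9 a10 a11 a12 a13 a14 a15 a16 a17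
  | e7 => Vec a0 a1 a2 a3 a4 a5 a6 false a8 a9 a10 a11 a12 a13 a14 a15 a16 a17
  | e8 => Vec a0 a1 a2 a3 a4 a5 a6 a7 false a9 a10 a11 a12 a13 a14 a15 a16 a17
  | e9 => Vec a0 a1 a2 a3 a4 a5 a6 a7 a8 false a10 a11 a12 a13 a14 a15 a16 a17
  | e10 => Vec a0 a1 a2 a3 a4 a5 a6 a7 a8 a9 false a11 a12 a13 a14 a15 a16 a17
  | e11 => Vec a0 a1 a2 a3 a4 a5 a6 a7 a8 a9 a10 false a12 a13 a14 a15 a16 a17
  | e12 => Vec a0 a1 a2 a3 a4 a5 a6 a7 a8 a9 a10 a11 false a13 a14 a15 a16 a17
  | e13 => Vec a0 a1 a2 a3 a4 a5 a6 a7 a8 a9 a10 a11 a12 false a14 a15 a16 a17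
  | e14 => Vec a0 a1 a2 a3 a4 a5 a6 a7 a8 a9 a10 a11 a12 a13 false a15 a16 a17
  | e15 => Vec a0 a1 a2 a3 a4 a5 a6 a7 a8 a9 a10 a11 a12 a13 a14 false a16 a17
  | e16 => Vec a0 a1 a2 a3 a4 a5 a6 a7 a8 a9 a10 a11 a12 a13 a14 a15 false a17
  | e17 => Vec a0 a1 a2 a3 a4 a5 a6 a7 a8 a9 a10 a11 a12 a13 a14 a15 a16 false
  end.

Definition elt_of n :=
  match n with 0 => e0 | 1 => e1 | 2 => e2 | 3 => e3 | 4 => e4 | 5 => e5 | 6 => e6 | 7
  => e7 | 8 => e8 | 9 => e9 | 10 => e10 | 11 => e11 | 12 => e12 | 13 => e13 | 14 => e14
  | 15 => e15 | 16 => e16 | _ => e17 end.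

Definition vec_of A (F : nat -> A) :=
  Vec (F 0) (F 1) (F 2) (F 3) (F 4) (F 5) (F 6) (F 7) (F 8) (F 9) (F 10) (F 11) (F 12)
  (F 13) (F 14) (F 15) (F 16) (F 17).

Lemma get_vec_of A (F : nat -> A) i : i < 18 -> get (vec_of F) (elt_of i) = F i.
Proof. by do 18! case: i => [|i] //. Qed.

Lemma get_clear v i j : i < 18 -> j < 18 ->
  get (clear v (elt_of i)) (elt_of j) = (j != i) && get v (elt_of j).
Proof.
by case: v => >; do 18! (case: i => [|i]; first by do 18! case: j => [|j] //).
Qed.

(** A zipper: p holds the entries already passed over, so each choice y comes with the remaining
    ones. The explicit [if] stops at the first success even under call-by-value evaluation. *)
Fixpoint has_rem (P : elt -> seq elt -> bool) (p q : seq elt) :=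
  if q is y :: q' then if P y (catrev p q') then true else has_rem P (y :: p) q'
  else false.

(* r1, r2, r3 are the rows of the division table at the last three entries of the
   partial terrace, R lists the unused elements, and c1, c2, c3 mark the differences
   at distance 1, 2, 3 that are still available (c3 only matters if b holds). *)
Fixpoint terrace_dfs b (q : vec (vec elt)) fuel (r1 r2 r3 : vec elt) (R : seq elt)
    (c1 c2 c3 : vec bool) : bool :=
  if fuel is fuel'.+1 then
    has_rem (fun y R' =>
      let d1 := get r1 y in
      if get c1 d1 then
        let d2 := get r2 y in
        if get c2 d2 then
          let d3 := get r3 y in
          if (if b then get c3 d3 else true) then
            terrace_dfs b q fuel' (get q y) r1 r2 R' (clear c1 d1) (clear c2 d2) (clear c3 d3)
          else false
        else false
      else false) [::] R
  else true.

Definition div_table (t : table) := vec_of (fun x => vec_of (fun y => elt_of (ldiv t x y))).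

Definition avail_init (t : table) m pre :=
  foldr (fun d c => clear c (elt_of d)) (vec_of (fun _ => true)) (diffs t m (size pre) pre).

Definition dfs_from b (t : table) pre :=
  let q := div_table t in
  let row e := get q (elt_of (nth 0 pre (size pre - e))) in
  terrace_dfs b q (size t - size pre) (row 1) (row 2) (row 3)
    [seq elt_of x | x <- iota 0 (size t) & x \notin pre]
    (avail_init t 1 pre) (avail_init t 2 pre) (avail_init t 3 pre).

Fixpoint orbit_reps fuel (A : seq (seq nat)) (L : seq nat) :=
  if fuel is fuel'.+1 then
    if L is x :: L' then
      x :: orbit_reps fuel' A
             [seq y <- L' | y \notin [seq nth 0 phi x | phi <- A]]
    else [::]
  else [::].

(* A lists automorphisms fixing the prefix pre; as long as it is not trivial, only
   representatives of its orbits are tried as the next entry. *)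
Fixpoint sym_search fuel b (t : table) (A : seq (seq nat)) pre :=
  if uniq (diffs t 1 (size pre) pre) && uniq (diffs t 2 (size pre) pre) then
    (* [dfs_from] looks back three entries, so it is called only on prefixes of length at least
       3. *)
    if (2 < size pre) && [|| fuel == 0, size A <= 1 | size t <= size pre] then ~~ dfs_from b t pre
    else if fuel is fuel'.+1 then
      all (fun x => sym_search fuel' b t [seq phi <- A | nth 0 phi x == x] (rcons pre x))
        (orbit_reps (size t) A [seq x <- iota 0 (size t) | x \notin pre])
    else false
  else true.

(** 18 is the capacity of [vec]. At most 6 entries after the identity are chosen with symmetry
    breaking. With two elements or fewer, a complete prefix would be too short for [dfs_from] and
    would be refuted for lack of candidates, hence the bound from below. *)
Definition no_terrace_search b (t : table) (A : seq (seq nat)) :=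
  [&& size t <= 18, 2 < size t, all (table_iso t t) A & sym_search 6 b t A [:: 0]].

(** A need not be closed under composition: each discarded entry is a direct image of the
    representative that discarded it. *)
Lemma orbit_repsP fuel A L y : size L <= fuel -> y \in L ->
  exists2 x, x \in orbit_reps fuel A L & y = x \/ exists2 phi, phi \in A & y = nth 0 phi x.
Proof.
elim: fuel L => [|fuel IH] [|x L] //= szL; rewrite inE.
case: (eqVneq y x) => [-> _ | _ /= Ly]; first by exists x; [rewrite inE eqxx | left].
have [/mapP[phi Aphi ->] | xy] := boolP (y \in [seq nth 0 phi x | phi <- A]).
  by exists x; [rewrite inE eqxx | right; exists phi].
set L' := filter _ L; have szL' : size L' <= fuel.
  by rewrite -ltnS (leq_ltn_trans _ szL) // size_filter count_size.
have L'y : y \in L' by rewrite mem_filter xy.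
by have [z Lz Ez] := IH _ szL' L'y; exists z; rewrite // inE Lz orbT.
Qed.

(** The zipper returns the remaining entries in scrambled order, hence the quantification over all
    permutations R. *)
Lemma has_remP (P : elt -> seq elt -> bool) (p q : seq nat) y :
    y \in q ->
    (forall R, perm_eq R (p ++ rem y q) -> P (elt_of y) (map elt_of R)) ->
  has_rem P (map elt_of p) (map elt_of q).
Proof.
elim: q p => [|x q IHq] //= p; rewrite inE.
case: (eqVneq x y) => [<- _ Py | neq_xy /= qy Py].
  by rewrite catrevE -map_rev -map_cat Py // perm_cat2r perm_rev.
case: ifP => // _; apply: (IHq (x :: p)) => // R eqR; apply: Py.
by apply: perm_trans eqR _; rewrite perm_sym perm_catC /= perm_cons perm_catC.
Qed.

(** * Completeness of the depth-first search along a given terrace *)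

Section SearchSound.

Variables (t : table) (k : nat) (s : seq nat).
Hypotheses (n_le18 : size t <= 18) (k_gt1 : 1 < k).
Hypothesis ldiv_lt : forall i j, i < size t -> j < size t -> ldiv t i j < size t.
Hypothesis ts : table_terrace k t s.

Let size_s : size s = size t.
Proof. by case/andP: ts => /perm_size->; rewrite size_iota. Qed.

Let nth_s d : d < size t -> nth 0 s d < size t.
Proof.
move=> ltd; have /andP[/perm_mem eq_s _] := ts.
have: nth 0 s d \in s by rewrite mem_nth ?size_s.
by rewrite eq_s mem_iota.
Qed.

Let diffsS m d : m <= d ->
  diffs t m d.+1 s = rcons (diffs t m d s) (ldiv t (nth 0 s (d - m)) (nth 0 s d)).
Proof.
by move=> le_md; rewrite /diffs subSn // -addn1 iotaD map_cat cats1 /= subnK.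
Qed.

Let diff_fresh m d : 0 < m <= k -> m <= d < size t ->
  ldiv t (nth 0 s (d - m)) (nth 0 s d) \notin diffs t m d s.
Proof.
move=> le_mk /andP[le_md ltd]; have /andP[_ /allP/(_ m)] := ts.
rewrite mem_iota add1n => /(_ le_mk); rewrite size_s.
have -> : diffs t m (size t) s
    = diffs t m d.+1 s ++ [seq ldiv t (nth 0 s i) (nth 0 s (i + m))
                             | i <- iota (d.+1 - m) (size t - d.+1)].
  rewrite /diffs -map_cat -iotaD; congr (map _ (iota _ _)).
  by rewrite addnC addnBA 1?leqW // subnK.
by rewrite diffsS // cat_uniq rcons_uniq => /andP[/andP[]].
Qed.

Definition avail m d (c : vec bool) :=
  forall i, i < 18 -> get c (elt_of i) = (i \notin diffs t m d s).

Lemma avail_clear m d c : m <= d < size t -> avail m d c ->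
  avail m d.+1 (clear c (elt_of (ldiv t (nth 0 s (d - m)) (nth 0 s d)))).
Proof.
move=> /andP[le_md ltd] av i lti.
rewrite get_clear // ?av // ?diffsS ?mem_rcons ?inE ?negb_or //.
by apply: leq_trans n_le18; apply: ldiv_lt; apply: nth_s; rewrite // (leq_ltn_trans (leq_subr _ _)).
Qed.

Lemma dfs_complete fuel d R c1 c2 c3 :
    (d + fuel = size t)%N -> 2 < d -> perm_eq R (drop d s) ->
    avail 1 d c1 -> avail 2 d c2 -> (2 < k -> avail 3 d c3) ->
  let row e := get (div_table t) (elt_of (nth 0 s (d - e))) in
  terrace_dfs (2 < k) (div_table t) fuel (row 1) (row 2) (row 3) (map elt_of R) c1 c2 c3.
Proof.
elim: fuel d R c1 c2 c3 => [|fuel IH] //= d R c1 c2 c3 sz_t d_gt2 permR av1 av2 av3.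
have ltd : d < size t by rewrite -sz_t addnS ltnS leq_addr.
have drop_d : drop d s = nth 0 s d :: drop d.+1 s by rewrite (drop_nth 0) ?size_s.
set y := nth 0 s d in drop_d; have lty : y < size t := nth_s ltd.
have Ry : y \in R by rewrite (perm_mem permR) drop_d mem_head.
have rowE e : 0 < e <= d -> get (get (div_table t) (elt_of (nth 0 s (d - e)))) (elt_of y)
                = elt_of (ldiv t (nth 0 s (d - e)) y).
  case/andP=> e_gt0 le_ed; have lt_de : d - e < size t by rewrite (leq_ltn_trans (leq_subr _ _)).
  by rewrite !get_vec_of // (leq_trans _ n_le18) // nth_s.
have lt_div e : ldiv t (nth 0 s (d - e)) y < 18.
  apply: leq_trans n_le18; apply: ldiv_lt => //.
  by apply: nth_s; rewrite (leq_ltn_trans (leq_subr _ _)).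
have le_d e : e <= 3 -> e <= d by move=> le_e3; apply: leq_trans d_gt2.
apply: (@has_remP _ [::] R y Ry) => R' permR'.
rewrite !rowE ?le_d //.
rewrite av1 ?lt_div // diff_fresh ?(ltnW k_gt1) ?ltd ?le_d //.
rewrite av2 ?lt_div // diff_fresh ?ltd ?le_d //.
have -> : (if 2 < k then get c3 (elt_of (ldiv t (nth 0 s (d - 3)) y)) else true).
  by case: ifP => // k_gt2; rewrite av3 ?lt_div // diff_fresh ?ltd ?le_d.
have := IH d.+1 R' _ _ _ _ _ _ (avail_clear _ av1) (avail_clear _ av2)
  (fun k_gt2 => avail_clear _ (av3 k_gt2)).
rewrite /= !subSS subn0; apply; rewrite ?ltd ?le_d //.
- by rewrite addSnnS.
- exact: leqW.
apply: perm_trans permR' _; rewrite -(perm_cons y) -drop_d -(permPr permR) perm_sym.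
exact: perm_to_rem.
Qed.

End SearchSound.

Lemma prefix_diffs t m pre s :
  diffs t m (size pre) (pre ++ s) = diffs t m (size pre) pre.
Proof.
apply/eq_in_map=> i; rewrite mem_iota /= add0n ltn_subRL addnC => lti.
by rewrite !nth_cat lti (leq_ltn_trans (leq_addr _ _) lti).
Qed.

Lemma prefix_uniq t k m pre s : table_terrace k t (pre ++ s) -> 0 < m <= k ->
  uniq (diffs t m (size pre) pre).
Proof.
case/andP=> _ /allP Ds lemk; have := Ds m; rewrite mem_iota add1n ltnS => /(_ lemk).
rewrite -(prefix_diffs t m pre s) /diffs size_cat.
have: (size pre - m <= size pre + size s - m)%N by rewrite leq_sub2r ?leq_addr.
by move/subnKC=> <-; rewrite iotaD map_cat cat_uniq => /andP[].
Qed.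

Lemma dfs_from_complete (t : table) k pre s :
    size t <= 18 -> 2 < size pre -> 1 < k ->
    (forall x y, x < size t -> y < size t -> ldiv t x y < size t) ->
    table_terrace k t (pre ++ s) ->
  dfs_from (2 < k) t pre.
Proof.
move=> n_le18 pre_gt2 k_gt1 ldiv_lt ts; have /andP[perm_s _] := ts.
have lt_s x : x \in pre ++ s -> x < size t by rewrite (perm_mem perm_s) mem_iota.
have le_pre : size pre <= size t.
  by rewrite -(size_iota 0 (size t)) -(perm_size perm_s) size_cat leq_addr.
have avail_pre m : avail t (pre ++ s) m (size pre) (avail_init t m pre).
  move=> i lti; rewrite prefix_diffs /avail_init; set F := fun d c => _; set z := vec_of _.
  have: {subset diffs t m (size pre) pre <= gtn 18}.
    move=> _ /mapP[j + ->]; rewrite mem_iota /= add0n ltn_subRL addnC => ltj.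
    have ltj' := leq_ltn_trans (leq_addr _ _) ltj.
    by apply: leq_trans n_le18; apply: ldiv_lt; apply: lt_s; rewrite mem_cat mem_nth.
  elim: (diffs _ _ _ _) => [|d D IH] ltD; first exact: get_vec_of.
  rewrite (_ : foldr F z (d :: D) = clear (foldr F z D) (elt_of d)) //.
  have ltd : d < 18 by apply: ltD; rewrite mem_head.
  rewrite get_clear // inE negb_or IH // => x Dx.
  by apply: ltD; rewrite inE Dx orbT.
have nth_pre e : 0 < e -> nth 0 (pre ++ s) (size pre - e) = nth 0 pre (size pre - e).
  by move=> e_gt0; rewrite nth_cat ltn_subrL e_gt0 (ltn_trans _ pre_gt2).
have := @dfs_complete t k _ n_le18 k_gt1 ldiv_lt ts (size t - size pre) (size pre).
rewrite /= !nth_pre // drop_size_cat // /dfs_from; apply=> //; first exact: subnKC.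
have := perm_uniq perm_s; rewrite iota_uniq cat_uniq => /and3P[_ /hasPn Ds us].
apply: uniq_perm; rewrite ?filter_uniq ?iota_uniq // => x.
rewrite mem_filter -(perm_mem perm_s) mem_cat.
by case: (boolP (x \in s)) => [/Ds-> | _]; rewrite ?orbT // orbF andNb.
Qed.

(** The image is taken under the inverse of phi, because an entry phi x has to be brought back to
    its orbit representative x. Composing f with phi gives another model of G, in which the new
    indices name the same group elements. *)
Lemma table_terrace_auto (gT : finGroupType) (G : {group gT}) t f phi k s :
    model G t f -> table_iso t t phi -> table_terrace k t s ->
  table_terrace k t [seq index x phi | x <- s].
Proof.
move=> mf iso_phi ts; have mf' := model_iso mf iso_phi.
have /and5P[_ _ /eqP sz_phi _ /and3P[uphi /allP ltphi _]] := iso_phi.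
have lts : all (gtn (size t)) s.
  by case/andP: ts => /perm_mem eq_s _; apply/allP=> i; rewrite eq_s mem_iota.
have mem_phi x : x \in s -> x \in phi.
  move/(allP lts) => ltx; have sub : {subset phi <= iota 0 (size t)}.
    by move=> y /ltphi; rewrite mem_iota.
  have [|_ ->] := uniq_min_size uphi sub; first by rewrite size_iota sz_phi.
  by rewrite mem_iota.
rewrite -(model_terrace mf'); last first.
  by apply/allP=> _ /mapP[x sx ->] /=; rewrite -sz_phi index_mem mem_phi.
rewrite -map_comp -(model_terrace mf) // in ts *.
suffices /eq_in_map-> : {in s, f \o nth 0 phi \o index^~ phi =1 f} by [].
by move=> x sx /=; rewrite nth_index ?mem_phi.
Qed.

Lemma orbit_reps_sub fuel A L x : x \in orbit_reps fuel A L -> x \in L.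
Proof.
elim: fuel L => [|fuel IH] [|y L] //=; rewrite !inE => /predU1P[->|/IH].
  by rewrite eqxx.
by rewrite mem_filter => /andP[_ ->]; rewrite orbT.
Qed.

(** If the next entry of the terrace is not a representative, the inverse of some automorphism in A
    makes it one; as A fixes pre pointwise, the transformed terrace still begins with pre. *)
Lemma sym_search_sound (gT : finGroupType) (G : {group gT}) t f k fuel A pre s :
    model G t f -> size t <= 18 -> 2 < size t -> 1 < k ->
    {in A, forall phi, table_iso t t phi} ->
    {in A & pre, forall phi x, nth 0 phi x = x} ->
    table_terrace k t (pre ++ s) ->
  ~~ sym_search fuel (2 < k) t A pre.
Proof.
move=> mf n_le18 n_gt2 k_gt1.
have ldiv_lt x y : x < size t -> y < size t -> ldiv t x y < size t.
  by move=> ltx lty; case: (ldivP mf ltx lty).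
elim: fuel A pre s => [|fuel IH] A pre s isoA fixA ts /=.
  rewrite !(prefix_uniq ts) ?(ltnW k_gt1) //; case: ifP => // /andP[pre_gt2 _].
  by rewrite negbK (dfs_from_complete n_le18 pre_gt2 k_gt1 ldiv_lt ts).
rewrite !(prefix_uniq ts) ?(ltnW k_gt1) //; case: ifP => [/andP[pre_gt2 _] | short].
  by rewrite negbK (dfs_from_complete n_le18 pre_gt2 k_gt1 ldiv_lt ts).
have /andP[perm_s _] := ts.
have sz_s : (size pre + size s)%N = size t.
  by rewrite -size_cat (perm_size perm_s) size_iota.
case: s => [|x0 s] in ts perm_s sz_s *.
  by rewrite addn0 in sz_s; rewrite sz_s leqnn !orbT n_gt2 in short.
have us := perm_uniq perm_s; rewrite iota_uniq in us.
have x0_pre : x0 \notin pre.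
  by move: us; rewrite cat_uniq => /and3P[_ /hasPn/(_ x0)]; rewrite mem_head => /(_ isT).
have x0_lt : x0 < size t.
  by have := perm_mem perm_s x0; rewrite mem_cat mem_head orbT mem_iota => /esym.
set L := [seq x <- _ | _]; have Lx0 : x0 \in L by rewrite mem_filter x0_pre mem_iota.
have szL : size L <= size t.
  by rewrite size_filter (leq_trans (count_size _ _)) // size_iota.
have [x reps_x Ex0] := orbit_repsP A szL Lx0; apply/allPn; exists x => //.
have x_lt : x < size t.
  by have := orbit_reps_sub reps_x; rewrite mem_filter mem_iota => /andP[].
have [s' ts'] : exists s', table_terrace k t (rcons pre x ++ s').
  case: Ex0 => [<- | [phi Aphi Ex0]]; first by exists s; rewrite cat_rcons.
  have /and5P[_ _ /eqP sz_phi _ /and3P[uphi _ _]] := isoA _ Aphi.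
  have lt_pre y : y \in pre -> y < size t.
    by move=> pre_y; have := perm_mem perm_s y; rewrite mem_cat pre_y mem_iota => /esym.
  have := table_terrace_auto mf (isoA _ Aphi) ts; rewrite map_cat /= Ex0.
  rewrite index_uniq ?sz_phi // -cat_rcons; set s' := map _ s; exists s'.
  suffices <- : [seq index y phi | y <- pre] = pre by [].
  rewrite -[RHS]map_id; apply/eq_in_map=> y pre_y.
  by rewrite -{1}(fixA phi y Aphi pre_y) index_uniq ?sz_phi ?lt_pre.
apply: IH ts' => [phi | phi y]; first by rewrite mem_filter => /andP[_ /isoA].
rewrite mem_filter mem_rcons inE => /andP[/eqP phi_x Aphi] /predU1P[-> // | ].
exact: fixA.
Qed.

Lemma no_terrace_searchP (gT : finGroupType) (G : {group gT}) t A k :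
  modelled G t -> 1 < k -> no_terrace_search (2 < k) t A -> ~ has_directed_terrace k G.
Proof.
move=> [f mf] k_gt1 /and4P[n_le18 n_gt2 /allP isoA searchP] tG.
have [s ts] := normalised_terrace mf tG.
have := @sym_search_sound _ _ _ _ k 6 A [:: 0] s mf n_le18 n_gt2 k_gt1 isoA _ ts.
rewrite searchP => /(_ _)/negP; apply=> //.
by move=> phi x /isoA/and5P[_ _ _ /eqP phi0 _]; rewrite inE => /eqP->.
Qed.

(** * Groups of order at most 22 *)

Definition eval_word (t : table) (im w : seq nat) :=
  foldl (fun x j => mult t x (nth 0 im j)) 0 w.

Definition words_step (t : table) (gens : seq nat) (acc : seq (nat * seq nat)) :=
  foldl (fun acc p =>
    foldl (fun acc j =>
      let z := mult t p.1 (nth 0 gens j) in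
      if z \in unzip1 acc then acc else rcons acc (z, rcons p.2 j))
    acc (iota 0 (size gens))) acc acc.

(** Entry x should be a word with value x, found by closing under right multiplication by
    generators; [table_generated] tests this by evaluation. The same words evaluated at other images
    of the generators give the candidate homomorphisms. *)
Definition words (t : table) (gens : seq nat) : seq (seq nat) :=
  let acc := iter (size t) (words_step t gens) [:: (0, [::])] in
  let elts := unzip1 acc in let ws := unzip2 acc in
  [seq nth [::] ws (index x elts) | x <- iota 0 (size t)].

Fixpoint tuples (cands : seq (seq nat)) : seq (seq nat) :=
  if cands is c :: cands' then
    let ims := tuples cands' in flatten [seq [seq y :: im | im <- ims] | y <- c]
  else [:: [::]].

Fixpoint has_tuple (P : pred (seq nat)) (cands : seq (seq nat)) :=
  if cands is c :: cands' then has (fun y => has_tuple (fun im => P (y :: im)) cands') c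
  else P [::].

Definition autos (t : table) (gens : seq nat) :=
  let ws := words t gens in
  [seq phi <- [seq [seq eval_word t im w | w <- ws]
                | im <- tuples (nseq (size gens) (iota 0 (size t)))] | table_iso t t phi].

(** The value is the order of x minus 1, as the trajectory starts at x itself. Orders are only ever
    compared or counted. *)
Definition table_order (t : table) x := index 0 (traject (fun y => mult t y x) x (size t)).

Definition orders (t : table) := [seq table_order t x | x <- iota 0 (size t)].

Definition same_order_cands (t1 t2 : table) (gens : seq nat) :=
  let o1 := orders t1 in let o2 := orders t2 in
  [seq [seq y <- iota 0 (size t1) | nth 0 o2 y == nth 0 o1 x] | x <- gens].

(* These invariants separate the groups of each order at most 22. *)
Definition invariants (t : table) :=
  let r := iota 0 (size t) in let o := orders t in
  [:: count (fun x => all (fun y => mult t x y == mult t y x) r) r,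
      size (undup [seq mult t x x | x <- r]) & [seq count_mem k o | k <- r]].

Definition recognised (tg : table * seq nat) (t2 : table) :=
  let: (t1, gens) := tg in
  let ws := words t1 gens in
  has_tuple (fun im => table_iso t1 t2 [seq eval_word t2 im w | w <- ws])
    (same_order_cands t1 t2 gens).

Definition table_generated (tg : table * seq nat) :=
  let: (t, gens) := tg in
  all (gtn (size t)) gens && ([seq eval_word t gens w | w <- words t gens] == iota 0 (size t)).

(** The tests on s and h are the compatibility conditions of a cyclic extension: x commutes with x^p
    = h, and the p-th iterate of s is conjugation by h. Comparing invariants only spares hopeless
    isomorphism searches. *)
Definition extensions_recognised (reps : nat -> seq (table * seq nat)) n p :=
  let keyed_reps := [seq (invariants tg.1, tg) | tg <- reps n] in
  all (fun tg : table * seq nat =>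
    let: (t, gens) := tg in
    let r := iota 0 (size t) in
    table_generated tg &&
    all (fun s =>
      all (fun h =>
        if (nth 0 s h == h) &&
           all (fun u => mult t u h == mult t h (iter p (nth 0 s) u)) r
        then
          let e := ext p t s h in let inv := invariants e in
          has (fun r => if r.1 == inv then recognised r.2 e else false) keyed_reps
        else true) r)
      (autos t gens)) (reps (n %/ p)).

(** * Exhaustiveness of the automorphism list, and cyclic extensions of prime index *)

Lemma mem_tuples (n : nat) (im : seq nat) : all (gtn n) im ->
  im \in tuples (nseq (size im) (iota 0 n)).
Proof.
elim: im => //= x im IH /andP[ltx /IH{}IH]; apply/flatten_mapP; exists x.
  by rewrite mem_iota.
exact: map_f.
Qed.

Lemma has_tupleP P cands : has_tuple P cands -> exists im, P im.
Proof.
by elim: cands P => [|c cands IH] P /=; [exists [::] | case/hasP=> y _ /IH[im]; exists (y :: im)].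
Qed.

Lemma eval_word_auto t phi gens w :
    table_iso t t phi -> 0 < size t -> all (gtn (size t)) gens ->
  eval_word t gens w < size t /\
  eval_word t (map (nth 0 phi) gens) w = nth 0 phi (eval_word t gens w).
Proof.
case/and5P=> sq1 /eqP sz_t /eqP sz_phi /eqP phi0 /and3P[uphi /allP ltphi /allP homphi].
(* A letter out of range reads as the default 0, the identity, which phi fixes; so w may be
   arbitrary. *)
move=> t_gt0 /allP lt_gens; have gensP j : nth 0 gens j < size t.
  have [ltj | ?] := ltnP j (size gens); last by rewrite nth_default.
  exact/lt_gens/mem_nth.
have nth_phi j : nth 0 (map (nth 0 phi) gens) j = nth 0 phi (nth 0 gens j).
  have [ltj | lej] := ltnP j (size gens); first by rewrite (nth_map 0).
  by rewrite [nth 0 gens j]nth_default // phi0 nth_default ?size_map.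
suffices evalP x : x < size t ->
    let ev im := foldl (fun x j => mult t x (nth 0 im j)) in
    ev gens x w < size t /\ ev (map (nth 0 phi) gens) (nth 0 phi x) w = nth 0 phi (ev gens x w).
  by have := evalP 0 t_gt0; rewrite /= phi0.
elim: w x => //= j w IHw x ltx.
have iotaP k : k < size t -> k \in iota 0 (size t) by rewrite mem_iota.
have /andP[lt_xj /eqP Exj] := allP (homphi x (iotaP x ltx)) _ (iotaP _ (gensP j)).
rewrite nth_phi (_ : mult t (nth 0 phi x) _ = nth 0 phi (mult t x (nth 0 gens j))) //.
exact: IHw.
Qed.

(** An automorphism is determined by the images of the generators, and [autos] tries every tuple of
    images, without pruning by order. *)
Lemma mem_autos t gens s :
  table_iso t t s -> 0 < size t -> table_generated (t, gens) -> s \in autos t gens.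
Proof.
move=> iso_s t_gt0 /andP[lt_gens /eqP wordsP].
have /and5P[_ _ /eqP sz_s _ /and3P[_ /allP lts _]] := iso_s.
rewrite mem_filter iso_s; apply/mapP; exists (map (nth 0 s) gens).
  rewrite -(size_map (nth 0 s)); apply: mem_tuples; rewrite all_map.
  by apply/allP=> x /(allP lt_gens) ltx; apply/lts/mem_nth; rewrite sz_s.
rewrite -{1}(mkseq_nth 0 s) /mkseq sz_s -wordsP -map_comp; apply: eq_map => w /=.
by have [_ ->] := eval_word_auto w iso_s t_gt0 lt_gens.
Qed.

Local Open Scope group_scope.

Lemma recognised_modelled (gT : finGroupType) (G : {group gT}) tg t :
  modelled G t -> recognised tg t -> modelled G tg.1.
Proof.
case: tg => t1 gens [f mf]; case/has_tupleP=> im iso_im.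
by exists (f \o nth 0 [seq eval_word t im w | w <- words t1 gens]); apply: (model_iso mf).
Qed.

(* Any element x outside N generates G modulo N, so that G consists of the products
   of a power of x and an element of N. *)
Lemma prime_extension_modelled (gT : finGroupType) (G N : {group gT}) t f p :
    model N t f -> N <| G -> prime p -> #|G : N| = p ->
  exists s h, [/\ table_iso t t s, h < size t, nth 0 s h = h,
    {in gtn (size t), forall u, mult t u h = mult t h (iter p (nth 0 s) u)} &
    modelled G (ext p t s h)].
Proof.
move=> mf nsNG p_pr indexN; have [sNG nNG] := andP nsNG.
have t_gt0 := model_size_gt0 mf.
have /subsetPn[x Gx N'x] : ~~ (G \subset N).
  by rewrite -indexg_eq1 indexN neq_ltn prime_gt1 ?orbT.
have nNx : x \in 'N(N) := subsetP nNG x Gx.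
have oGN : #|G / N| = p by rewrite card_quotient.
have defGN : G / N = <[coset N x]>.
  apply: nt_gen_prime; rewrite ?oGN // !inE mem_quotient // andbT.
  by apply: contra N'x => /eqP/coset_idr->.
have ox : #[coset N x] = p by rewrite orderE -defGN.
have Nxp : x ^+ p \in N.
  by apply: coset_idr; rewrite ?groupX // morphX //= -ox expg_order.
have Nconj u : u < size t -> f u ^ x \in N.
  by move=> ltu; rewrite memJ_norm ?(mem_model mf).
pose s := mkseq (fun u => model_index t f (f u ^ x)) (size t).
pose h := model_index t f (x ^+ p).
have nth_s u : u < size t -> nth 0 s u = model_index t f (f u ^ x).
  by move=> ltu; rewrite nth_mkseq.
have s_lt u : u < size t -> nth 0 s u < size t.
  by move=> ltu; rewrite nth_s //; case: (model_indexP mf (Nconj u ltu)).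
have sE u : u < size t -> f (nth 0 s u) = f u ^ x.
  by move=> ltu; rewrite nth_s //; case: (model_indexP mf (Nconj u ltu)).
have [lth hE] := model_indexP mf Nxp; rewrite -/h in lth hE.
have iterE l u : u < size t -> iter l (nth 0 s) u < size t /\
    f (iter l (nth 0 s) u) = f u ^ (x ^+ l).
  move=> ltu; elim: l => [|l [lt_l El]] /=; first by rewrite conjg1.
  by split; [apply: s_lt | rewrite sE // El -conjgM -expgSr].
exists s, h; split=> //.
- apply/and5P; split; rewrite ?(model_square mf) ?size_mkseq //.
    rewrite nth_s // (table_hom1 (model_hom mf)) conj1g -(table_hom1 (model_hom mf)).
    by rewrite (model_indexK mf).
  apply/and3P; split.
  - rewrite map_inj_in_uniq ?iota_uniq // => u v; rewrite !mem_iota /= => ltu ltv Euv.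
    apply: (model_inj mf) => //; apply: (conjg_inj x).
    by rewrite -!sE // !nth_s // Euv.
  - by apply/allP=> _ /(nthP 0)[u + <-]; rewrite size_mkseq; apply: s_lt.
  apply/allP=> u; rewrite mem_iota => ltu; apply/allP=> v; rewrite mem_iota => ltv.
  have lt_uv := model_mult_lt mf ltu ltv; apply/andP; split; first exact: lt_uv.
  apply/eqP/(model_inj mf); rewrite ?inE ?s_lt ?(model_mult_lt mf) ?s_lt //.
  by rewrite sE // !(model_multE mf) ?s_lt // conjMg !sE.
- by apply: (model_inj mf); rewrite ?inE ?s_lt // sE // hE conjgE -expgSr expgS mulKg.
- move=> u ltu; have [lt_pu Epu] := iterE p u ltu.
  apply: (model_inj mf); rewrite ?inE ?(model_mult_lt mf) //.
  by rewrite !(model_multE mf) // Epu hE -conjgC.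
have p_gt0 := prime_gt0 p_pr.
exists (fun i => x ^+ (i %/ size t) * f (i %% size t)).
have idxE k u : u < size t -> ((k * size t + u) %/ size t = k)%N /\
    ((k * size t + u) %% size t = u)%N.
  by move=> ltu; rewrite divnMDl // divn_small // addn0 modnMDl modn_small.
split.
- by apply: ext_hom => //; apply: model_hom mf.
- exact: square_mkseq.
- move=> i j; rewrite size_ext !inE => lti ltj Eij.
  have ltm k : k %% size t < size t by rewrite ltn_mod.
  have Nf k : f (k %% size t) \in N by apply: (mem_model mf).
  (* Modulo N only the power of x survives, and the coset of x has order p, so the exponents
     agree. *)
  have Ek : (i %/ size t = j %/ size t)%N.
    have cosetE a b : coset N (x ^+ a * f (b %% size t)) = coset N x ^+ a.
      have nNf : f (b %% size t) \in 'N(N) := subsetP (normG N) _ (Nf b).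
      by rewrite (coset_morphM (groupX a nNx) nNf) (coset_id (Nf b)) mulg1 (morphX _ a nNx).
    have := congr1 (coset N) Eij; rewrite !cosetE.
    by move/eqP; rewrite eq_expg_mod_order ox !modn_small ?ltn_divLR // => /eqP.
  move: Eij; rewrite Ek => /mulgI/(model_inj mf (ltm i) (ltm j)) Em.
  by rewrite (divn_eq i (size t)) (divn_eq j (size t)) Ek Em.
move=> y; split=> [Gy | [i _ <-]]; last first.
  by rewrite groupM ?groupX // (subsetP sNG) // (mem_model mf) // ltn_mod.
have: coset N y \in <[coset N x]> by rewrite -defGN mem_quotient.
case/cyclePmin=> k; rewrite ox => ltk Ey.
have Nxy : x ^- k * y \in N.
  apply: coset_idr; first by rewrite groupM ?groupV ?groupX // (subsetP nNG).
  by rewrite morphM ?groupV ?groupX ?(subsetP nNG) //= morphV ?groupX // morphX // Ey mulVg.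
have [ltu Eu] := model_indexP mf Nxy; set u := model_index _ _ _ in ltu Eu.
have [Ek Em] := idxE k u ltu; exists (k * size t + u)%N.
  by rewrite size_ext -ltn_divLR // Ek.
by rewrite Ek Em Eu mulKVg.
Qed.

(** * Solvability of the groups of order at most 22 *)

Lemma solvable_normal_Sylow (gT : finGroupType) (G : {group gT}) (q r : nat) :
    prime q -> all (fun d => (d %| #|G|) && (d %% q == 1) ==> (d == 1))%N (iota 0 #|G|.+1) ->
    r.-nat (#|G| %/ q ^ logn q #|G|)%N ->
  solvable G.
Proof.
move=> q_pr /allP divs r_nat.
(* The number of Sylow q-subgroups divides the order and is 1 modulo q, and 1 is the only such
   number by hypothesis. *)
have /normal_sylowP[P sylP nsPG] : #|'Syl_q(G)| == 1%N.
  have := divs #|'Syl_q(G)|; rewrite mem_iota /= ltnS card_Syl_dvd card_Syl_mod //.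
  by rewrite eqxx /=; apply; rewrite dvdn_leq ?cardG_gt0 ?card_Syl_dvd.
rewrite (series_sol nsPG) (pgroup_sol (pHall_pgroup sylP)) /=.
apply: (@pgroup_sol _ r); rewrite /pgroup card_quotient ?normal_norm //.
by rewrite -divgS ?normal_sub // (card_Hall sylP) p_part.
Qed.

Lemma solvable_card6 (gT : finGroupType) (G : {group gT}) : #|G| = 6 -> solvable G.
Proof. by move=> oG; apply: (@solvable_normal_Sylow _ _ 3 2); rewrite ?oG. Qed.

(* Two distinct Sylow 2-subgroups meet in a subgroup of order 2, which both of them
   normalise. *)
Lemma solvable_card12 (gT : finGroupType) (G : {group gT}) : #|G| = 12 -> solvable G.
Proof.
move=> oG; have [S sylS] := Sylow_exists 2 G; have sSG := pHall_sub sylS.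
have oS : #|S| = 4 by rewrite (card_Hall sylS) p_part oG.
have solS : solvable S := pgroup_sol (pHall_pgroup sylS).
have [nSG | /subsetPn[x Gx nSx]] := boolP (G \subset 'N(S)).
  have nsSG : S <| G by apply/andP.
  rewrite (series_sol nsSG) solS; apply: (@pgroup_sol _ 3).
  by rewrite /pgroup card_quotient // -divgS // oG oS.
pose K := S :&: S :^ x; have sSxG : S :^ x \subset G by rewrite -(conjGid Gx) conjSg.
have oSx : #|S :^ x| = 4 by rewrite cardJg.
have oK : #|K| = 2.
  have dvd_K : #|K| %| 4 by rewrite -oS cardSg ?subsetIl.
  have: #|K| != 4.
    apply: contra nSx => /eqP oK.
    have /eqP defKx : K == S :^ x by rewrite eqEcard subsetIr oSx oK.
    by rewrite inE -defKx subsetIl.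
  (* 16 is the product of the size of S * S^x, at most 12, and the order of K, so K is not
     trivial. *)
  have := mul_cardG S (S :^ x)%G; rewrite /= oS oSx -/K.
  have: #|S * (S :^ x)| <= 12 by rewrite -oG subset_leq_card // mul_subG.
  have := dvdn_leq (isT : 0 < 4) dvd_K; move: dvd_K.
  by case: #|K| => [|[|[|[|[|?]]]]] // _ _; rewrite muln1 => /[swap] <-.
have nKS : S :|: S :^ x \subset 'N(K).
  rewrite subUset; apply/andP; split; apply/normal_norm/index2_normal;
    by rewrite ?subsetIl ?subsetIr // -divgS ?subsetIl ?subsetIr // ?oS ?oSx oK.
have sKG : K \subset G by rewrite subIset ?sSG.
have nKG : K <| G.
  (* The order of L divides 12, is a multiple of 4 and is not 4, so L is all of G. *)
  apply/andP; split=> //; pose L := (S <*> S :^ x)%G.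
  suffices <- : L :=: G by rewrite gen_subG.
  have sLG : L \subset G by rewrite join_subG sSG.
  apply/eqP; rewrite eqEcard sLG oG /=.
  have dvdL : #|L| %| 12 by rewrite -oG cardSg.
  have dvd4 : 4 %| #|L| by rewrite -oS cardSg ?joing_subl.
  have: #|L| != 4.
    apply: contra nSx => /eqP oL.
    have /eqP defS : S == L :> {set gT} by rewrite eqEcard joing_subl oL oS.
    have /eqP defSx : S :^ x == L :> {set gT} by rewrite eqEcard joing_subr oL oSx.
    by rewrite inE defSx -defS.
  have: #|L| <= 12 by rewrite dvdn_leq.
  move: dvdL dvd4; by move: #|L| => l; do 12! case: l => [|l] //.
rewrite (series_sol nKG) (@solvable_card6 _ (G / K)%G).
  by rewrite andbT; apply: (@pgroup_sol _ 2); rewrite /pgroup oK.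
by rewrite card_quotient ?normal_norm // -divgS // oG oK.
Qed.

Definition small_primes : seq nat := [:: 2; 3; 5; 7; 11; 13; 17; 19].

Lemma mem_small_primes p : prime p -> p <= 22 -> p \in small_primes.
Proof.
have ok : all (fun p => prime p ==> (p \in small_primes)) (iota 0 23) by vm_compute.
move=> p_pr le_p; have: p \in iota 0 23 by rewrite mem_iota ltnS.
by move/(allP ok)/implyP; apply.
Qed.

(** Order 12 is the exception to the numerical test: three Sylow 2-subgroups or four Sylow
    3-subgroups are both allowed by the congruences. *)
Lemma small_solvable (gT : finGroupType) (G : {group gT}) : #|G| <= 22 -> solvable G.
Proof.
move=> le22; have [/solvable_card12 // | n12] := eqVneq #|G| 12.
pose sylow_ok (n q r : nat) := [&& prime q,
  all (fun d => (d %| n) && (d %% q == 1) ==> (d == 1))%N (iota 0 n.+1) &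
  r.-nat (n %/ q ^ logn q n)%N].
have ok : all (fun n => (n == 12) ||
    has (fun q => has (sylow_ok n q) small_primes) small_primes) (iota 1 22).
  by vm_compute.
have: #|G| \in iota 1 22 by rewrite mem_iota cardG_gt0 ltnS.
move/(allP ok); rewrite (negPf n12) => /hasP[q _ /hasP[r _ /and3P[q_pr divs r_nat]]].
exact: solvable_normal_Sylow q_pr divs r_nat.
Qed.

(** A maximal normal subgroup has a simple quotient, and a simple solvable group has prime order. *)
Lemma small_prime_index_normal (gT : finGroupType) (G : {group gT}) :
  1 < #|G| <= 22 -> exists2 N : {group gT}, N <| G & prime #|G : N|.
Proof.
case/andP=> G_gt1 /small_solvable solG.
have [N maxN] := ex_maxnormal_ntrivg (etrans (esym (cardG_gt1 G)) G_gt1).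
have nsNG := maxnormal_normal maxN; exists N => //.
rewrite -card_quotient ?normal_norm //; apply: simple_sol_prime (quotient_sol N solG) _.
by rewrite quotient_simple.
Qed.

(** * The list of groups of order at most 22 *)

Local Open Scope nat_scope.

Definition mult_by n c : seq nat := mkseq (fun i => (c * i) %% n) n.

(** For compatible parameters this is the group < a, b | a^n = 1, b^p = a^h, a^b = a^c >, with b^k
    a^i at index k n + i. *)
Definition metacyc n c p h := ext p (cyc n) (mult_by n c) h.

Definition by_cyc (t : table) p := ext p t (iota 0 (size t)) 0.

Definition tV4 := by_cyc (cyc 2) 2.
Definition tS3 := metacyc 3 2 2 0.
Definition tC4xC2 := by_cyc (cyc 4) 2.
Definition tE8 := by_cyc tV4 2.
Definition tD8 := metacyc 4 3 2 0.
Definition tQ8 := metacyc 4 3 2 2.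
Definition tC3xC3 := by_cyc (cyc 3) 3.
Definition tD10 := metacyc 5 4 2 0.
Definition tD12 := metacyc 6 5 2 0.
Definition tQ12 := metacyc 6 5 2 3.
Definition tA4 := ext 3 tV4 [:: 0; 2; 3; 1] 0.
Definition tD14 := metacyc 7 6 2 0.
Definition tD16 := metacyc 8 7 2 0.
Definition tSD16 := metacyc 8 3 2 0.
Definition tQ16 := metacyc 8 7 2 4.
Definition tM16 := metacyc 8 5 2 0.
Definition tD8xC2 := by_cyc tD8 2.
Definition tQ8xC2 := by_cyc tQ8 2.
Definition tC4sdC4 := metacyc 4 3 4 0.
(** With a at index 1 and b at index 4 of C4 x C2, the new involution sends a to a b and fixes b. In
    [tD8oC4] it fixes a and sends b to a^2 b; in [tC3xC3sdC2] it inverts every element. *)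
Definition tC4xC2sdC2 := ext 2 tC4xC2 [:: 0; 5; 2; 7; 4; 1; 6; 3] 0.
Definition tD8oC4 := ext 2 tC4xC2 [:: 0; 1; 2; 3; 6; 7; 4; 5] 0.
Definition tC6xC3 := by_cyc (cyc 6) 3.
Definition tD18 := metacyc 9 8 2 0.
Definition tS3xC3 := by_cyc tS3 3.
Definition tC3xC3sdC2 := ext 2 tC3xC3 [:: 0; 2; 1; 6; 8; 7; 3; 5; 4] 0.
Definition tD20 := metacyc 10 9 2 0.
Definition tQ20 := metacyc 10 9 2 5.
Definition tF20 := metacyc 5 2 4 0.
Definition tF21 := metacyc 7 2 3 0.
Definition tD22 := metacyc 11 10 2 0.

(* The non-cyclic groups of order n, each with generators. *)
Definition noncyclic_reps n : seq (table * seq nat) :=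
  match n with
  | 4 => [:: (tV4, [:: 1; 2])]
  | 6 => [:: (tS3, [:: 1; 3])]
  | 8 => [:: (tC4xC2, [:: 1; 4]); (tE8, [:: 1; 2; 4]); (tD8, [:: 1; 4]); (tQ8, [:: 1; 4])]
  | 9 => [:: (tC3xC3, [:: 1; 3])]
  | 10 => [:: (tD10, [:: 1; 5])]
  | 12 => [:: (by_cyc (cyc 6) 2, [:: 1; 6]); (tD12, [:: 1; 6]); (tQ12, [:: 1; 6]);
              (tA4, [:: 1; 4])]
  | 14 => [:: (tD14, [:: 1; 7])]
  | 16 => [:: (by_cyc (cyc 8) 2, [:: 1; 8]); (by_cyc (cyc 4) 4, [:: 1; 4]);
              (by_cyc tC4xC2 2, [:: 1; 4; 8]); (by_cyc tE8 2, [:: 1; 2; 4; 8]);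
              (tD16, [:: 1; 8]); (tSD16, [:: 1; 8]); (tQ16, [:: 1; 8]);
              (tM16, [:: 1; 8]); (tD8xC2, [:: 1; 4; 8]); (tQ8xC2, [:: 1; 4; 8]);
              (tC4sdC4, [:: 1; 4]); (tC4xC2sdC2, [:: 1; 8]); (tD8oC4, [:: 1; 4; 8])]
  | 18 => [:: (tC6xC3, [:: 1; 6]); (tD18, [:: 1; 9]); (tS3xC3, [:: 1; 9]);
              (tC3xC3sdC2, [:: 1; 3; 9])]
  | 20 => [:: (by_cyc (cyc 10) 2, [:: 1; 10]); (tD20, [:: 1; 10]); (tQ20, [:: 1; 10]);
              (tF20, [:: 1; 5])]
  | 21 => [:: (tF21, [:: 1; 7])]
  | 22 => [:: (tD22, [:: 1; 11])]
  | _ => [::]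
  end.

(** Reducing 1 modulo n keeps the generator in range for the trivial group. *)
Definition reps n : seq (table * seq nat) := (cyc n, [:: 1 %% n]) :: noncyclic_reps n.

Local Open Scope group_scope.

Lemma extensions_recognised_reps n p : 1 < n <= 22 -> p \in small_primes -> p %| n ->
  extensions_recognised reps n p.
Proof.
have ok : all (fun n => all (fun p => if p %| n then extensions_recognised reps n p
                                      else true) small_primes) (iota 2 21).
  (* Lazy conversion lets [has_tuple] stop at the first isomorphism, where call-by-value evaluation
     would go through all the tuples. *)
  by exact_no_check (erefl true).
case/andP=> n_gt1 le_n p_small dvd_pn.
have: n \in iota 2 21 by rewrite mem_iota n_gt1.
by move/(allP ok)/allP/(_ p p_small); rewrite dvd_pn.
Qed.

Theorem small_groups (gT : finGroupType) (G : {group gT}) : #|G| <= 22 ->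
  exists2 tg, tg \in reps #|G| & modelled G tg.1.
Proof.
have [n] := ubnP #|G|; elim: n => // n IHn in gT G *; rewrite ltnS => le_n le22.
have [G_le1 | G_gt1] := leqP #|G| 1.
  have oG : #|G| = 1%N by apply/eqP; rewrite eqn_leq G_le1 cardG_gt0.
  exists (cyc 1, [:: 1 %% 1])%N; first by rewrite oG mem_head.
  exists (fun=> 1); split=> //.
  - by split=> // i j; rewrite !ltnS !leqn0 => /eqP-> /eqP->; rewrite mulg1.
  - by move=> i j; rewrite !inE !ltnS !leqn0 => /eqP-> /eqP->.
  have /eqP-> : G :==: 1 by rewrite trivg_card1 oG.
  by move=> x; rewrite inE; split=> [/eqP-> | [i _ <-] //]; exists 0.
have [|N nsNG] := @small_prime_index_normal _ G; first by rewrite G_gt1.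
set p := #|G : N| => p_pr; have p_gt0 := prime_gt0 p_pr.
have oG : (#|N| * p)%N = #|G| by rewrite Lagrange ?normal_sub.
have oN : #|N| = (#|G| %/ p)%N by rewrite -oG mulnK.
have ltN : #|N| < #|G| by rewrite oN ltn_Pdiv ?prime_gt1 ?cardG_gt0.
have [||[t gens] reps_t [f mf]] := IHn _ N; rewrite ?(leq_trans ltN) ?(ltnW (leq_trans ltN _)) //.
have [s [h [iso_s lth sh hP mGe]]] := prime_extension_modelled mf nsNG p_pr erefl.
have p_small : p \in small_primes.
  by rewrite mem_small_primes // (leq_trans _ le22) // -oG leq_pmull.
have := @extensions_recognised_reps #|G| p.
rewrite G_gt1 le22 p_small -oG dvdn_mull // oG => /(_ isT isT isT)/allP/(_ (t, gens)).
rewrite -oN => /(_ reps_t)/andP[gen_t /allP/(_ s)].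
rewrite mem_autos ?(model_size_gt0 mf) // => /(_ isT)/allP/(_ h).
rewrite mem_iota => /(_ lth); rewrite sh eqxx andTb.
have -> : all (fun u => mult t u h == mult t h (iter p (nth 0 s) u)) (iota 0 (size t)).
  by apply/allP=> u; rewrite mem_iota => ltu; apply/eqP/hP.
move/hasP=> [_ /mapP[tg reps_tg ->] /=]; case: ifP => // _ rec_tg; exists tg => //.
exact: recognised_modelled mGe rec_tg.
Qed.

Local Close Scope group_scope.

(** * Groups without terraces *)

(** Unlike [autos], this list is pruned by element orders without proof: the search is sound for any
    list of automorphisms, and a shorter one only makes it slower. *)
Definition order_autos (tg : table * seq nat) :=
  let: (t, gens) := tg in
  let ws := words t gens in
  [seq phi <- [seq [seq eval_word t im w | w <- ws]
                | im <- tuples (same_order_cands t t gens)] | table_iso t t phi].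

Definition no_terrace b tg := no_terrace_search b tg.1 (order_autos tg).

Definition no_T2_reps : seq (table * seq nat) :=
  [:: (tS3, [:: 1; 3]); (tD8, [:: 1; 4]); (tQ8, [:: 1; 4]); (tD10, [:: 1; 5]);
      (tD12, [:: 1; 6]); (tD14, [:: 1; 7]); (tD16, [:: 1; 8]); (tSD16, [:: 1; 8]);
      (tD8xC2, [:: 1; 4; 8]); (tQ8xC2, [:: 1; 4; 8]); (tC4sdC4, [:: 1; 4]);
      (tC4xC2sdC2, [:: 1; 8])].

(** 8 and 14 are the even n below 20 with n + 1 composite. Their cyclic groups have a unique
    involution, which is the product of all the elements, so telescoping gives no contradiction. The
    non-abelian entries are the tables of [T2_reps]. *)
Definition no_T3_reps_le16 : seq (table * seq nat) :=
  [:: (cyc 8, [:: 1]); (cyc 14, [:: 1]); (tQ12, [:: 1; 6]); (tA4, [:: 1; 4]);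
      (tQ16, [:: 1; 8]); (tM16, [:: 1; 8]); (tD8oC4, [:: 1; 4; 8])].

Definition no_T3_reps : seq (table * seq nat) :=
  [:: (tC6xC3, [:: 1; 6]), (tS3xC3, [:: 1; 9]), (tD18, [:: 1; 9]),
      (tC3xC3sdC2, [:: 1; 3; 9]) & no_T3_reps_le16].

Lemma no_T2_search_lt16 : all (no_terrace false) (take 6 no_T2_reps).
Proof. by vm_cast_no_check (erefl true). Qed.

Lemma no_T2_search_16a : all (no_terrace false) (take 2 (drop 6 no_T2_reps)).
Proof. by vm_cast_no_check (erefl true). Qed.

Lemma no_T2_search_16b : all (no_terrace false) (drop 8 no_T2_reps).
Proof. by vm_cast_no_check (erefl true). Qed.

Lemma no_T2_search : all (no_terrace false) no_T2_reps.
Proof.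
rewrite -[no_T2_reps](cat_take_drop 6) all_cat no_T2_search_lt16.
by rewrite -[drop 6 _](cat_take_drop 2) all_cat no_T2_search_16a no_T2_search_16b.
Qed.

Lemma no_T3_search_le16 : all (no_terrace true) no_T3_reps_le16.
Proof. by vm_cast_no_check (erefl true). Qed.

Lemma no_T3_search_C6xC3 : no_terrace true (tC6xC3, [:: 1; 6]).
Proof. by vm_cast_no_check (erefl true). Qed.

Lemma no_T3_search_S3xC3 : no_terrace true (tS3xC3, [:: 1; 9]).
Proof. by vm_cast_no_check (erefl true). Qed.

Lemma no_T3_search_D18 : no_terrace true (tD18, [:: 1; 9]).
Proof. by vm_cast_no_check (erefl true). Qed.

Lemma no_T3_search_C3xC3sdC2 : no_terrace true (tC3xC3sdC2, [:: 1; 3; 9]).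
Proof. by vm_cast_no_check (erefl true). Qed.

Lemma no_T3_search : all (no_terrace true) no_T3_reps.
Proof.
by apply/and5P; split; [exact: no_T3_search_C6xC3 | exact: no_T3_search_S3xC3 |
  exact: no_T3_search_D18 | exact: no_T3_search_C3xC3sdC2 | exact: no_T3_search_le16].
Qed.

Lemma modelled_no_T2 (gT : finGroupType) (G : {group gT}) tg :
  modelled G tg.1 -> tg \in no_T2_reps -> ~ has_directed_terrace 2 G.
Proof. by move=> mG /(allP no_T2_search)/(no_terrace_searchP mG (isT : 1 < 2)). Qed.

Lemma modelled_no_T3 (gT : finGroupType) (G : {group gT}) tg :
  modelled G tg.1 -> tg \in no_T3_reps -> ~ has_directed_terrace 3 G.
Proof. by move=> mG /(allP no_T3_search)/(no_terrace_searchP mG (isT : 1 < 3)). Qed.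

(** * Presentations *)

Definition group_table (t : table) :=
  let n := size t in let r := iota 0 n in
  [&& 0 < n, square_table t &
      all (fun i => [&& mult t 0 i == i, has (fun j => mult t j i == 0) r &
        all (fun j => (mult t i j < n) &&
          all (fun k => mult t (mult t i j) k == mult t i (mult t j k)) r) r]) r].

(** The proof [ht] indexes the type so that the group laws it supplies can be attached as a
    structure. *)
Definition table_group (t : table) (ht : group_table t) : predArgType := 'I_(size t).

HB.instance Definition _ t (ht : group_table t) := Finite.on (table_group ht).

Section TableGroup.

Variables (t : table) (ht : group_table t).

Let n_gt0 : 0 < size t. Proof. by case/and3P: ht. Qed.

Let table_groupP i : i < size t ->
  [/\ mult t 0 i = i, has (fun j => mult t j i == 0) (iota 0 (size t)) &
   forall j, j < size t -> mult t i j < size t /\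
     forall k, k < size t -> mult t (mult t i j) k = mult t i (mult t j k)].
Proof.
have iotaP j : j < size t -> j \in iota 0 (size t) by rewrite mem_iota.
move=> lti; have /and3P[_ _ /allP/(_ i (iotaP i lti))] := ht.
case/and3P=> /eqP E0 hasV /allP assoc; split=> // j /iotaP/assoc/andP[ltij /allP assoc_ij].
by split=> // k /iotaP/assoc_ij/eqP.
Qed.

Definition table_mul (x y : table_group ht) : table_group ht :=
  insubd (Ordinal n_gt0) (mult t (x : 'I__) (y : 'I__)).

Definition table_one : table_group ht := Ordinal n_gt0.

Definition table_inv (x : table_group ht) : table_group ht :=
  insubd (Ordinal n_gt0) (find (fun j => mult t j (x : 'I__) == 0) (iota 0 (size t))).

Let val_mul (x y : table_group ht) :
  nat_of_ord (table_mul x y) = mult t (x : 'I__) (y : 'I__).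
Proof.
rewrite /table_mul val_insubd; have [_ _ /(_ _ (ltn_ord y))[-> //]] := table_groupP (ltn_ord x).
Qed.

Lemma table_mulA : associative table_mul.
Proof.
move=> x y z; apply: val_inj; rewrite /= !val_mul.
by have [_ _ /(_ _ (ltn_ord y))[_ ->]] := table_groupP (ltn_ord x).
Qed.

Lemma table_mul1 : left_id table_one table_mul.
Proof.
by move=> x; apply: val_inj; rewrite /= val_mul; case: (table_groupP (ltn_ord x)).
Qed.

Lemma table_mulV : left_inverse table_one table_inv table_mul.
Proof.
move=> x; apply: val_inj; rewrite /= val_mul.
have [_ hasV _] := table_groupP (ltn_ord x); have := hasV; rewrite has_find size_iota => ltV.
rewrite val_insubd ltV; apply/eqP; have := nth_find 0 hasV.
by rewrite nth_iota.
Qed.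

HB.instance Definition _ :=
  Finite_isGroup.Build (table_group ht) table_mulA table_mul1 table_mulV.

Lemma table_group_modelled : modelled [set: table_group ht] t.
Proof.
pose f i : table_group ht := insubd (Ordinal n_gt0) i.
have val_f i : i < size t -> nat_of_ord (f i) = i by move=> lti; rewrite val_insubd lti.
exists f; split.
- split=> [|i j lti ltj]; first by apply: val_inj; rewrite /= val_f.
  have [_ _ /(_ _ ltj)[ltij _]] := table_groupP lti; split=> //.
  by apply: val_inj; rewrite /= val_f // val_mul !val_f.
- by case/and3P: ht.
- by move=> i j lti ltj /(congr1 (@nat_of_ord _)); rewrite !val_f.
move=> x; rewrite inE; split=> // _; exists (x : 'I__) => //.
by apply: val_inj; rewrite /= val_f.
Qed.

End TableGroup.

Local Open Scope group_scope.

(** * Homomorphisms out of tables, generation and relations *)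

Lemma isog_modelled (gT rT : finGroupType) (G : {group gT}) (H : {group rT}) t :
  G \isog H -> modelled H t -> modelled G t.
Proof.
rewrite isog_sym => /isogP[phi inj_phi <-] [f mf].
have fH i : i < size t -> f i \in H by apply: (mem_model mf).
exists (phi \o f); split=> [||i j lti ltj /= |x].
- case: (model_hom mf) => f1 fM; split=> [|i j lti ltj] /=; first by rewrite f1 morph1.
  by have [lt_ij ->] := fM i j lti ltj; rewrite morphM ?fH.
- exact: model_square mf.
- by move/(injmP inj_phi)/(model_inj mf lti ltj); apply; apply: fH.
split=> [/morphimP[y _ Hy ->] | [i lti <-]]; last by rewrite mem_morphim ?fH.
by have [i lti <-] := (model_im mf y).1 Hy; exists i.
Qed.

Lemma generated_ind (gT : finGroupType) (K : {group gT}) t f gens :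
    table_hom t f -> table_generated (t, gens) -> {in gens, forall g, f g \in K} ->
  forall i, i < size t -> f i \in K.
Proof.
move=> [f1 fM] /andP[/allP lt_gens /eqP gen_t] Kgens i lti.
have: i \in [seq eval_word t gens w | w <- words t gens] by rewrite gen_t mem_iota.
have t_gt0 : 0 < size t by apply: leq_trans lti.
have gensP j : nth 0 gens j < size t /\ f (nth 0 gens j) \in K.
  have [ltj | ?] := ltnP j (size gens); last by rewrite nth_default // f1 group1.
  by split; [apply/lt_gens/mem_nth | apply/Kgens/mem_nth].
case/mapP=> w _ ->; rewrite /eval_word.
suffices evalP x : x < size t /\ f x \in K ->
    let y := foldl (fun x j => mult t x (nth 0 gens j)) x w in y < size t /\ f y \in K.
  by case: (evalP 0); rewrite ?f1.
elim: w x => //= j w IHw x [ltx Kx]; apply: IHw.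
by have [ltj Kj] := gensP j; have [lt_xj ->] := fM _ _ ltx ltj; rewrite groupM.
Qed.

(** This is the universal half of a presentation: elements satisfying the relations define a
    morphism from G onto the group they generate. Generation is stated as minimality among
    subgroups, which suits two and three generators alike. *)
Lemma table_homg (gT rT : finGroupType) (G : {group gT}) (H : {group rT}) t gens f f' :
    model G t f -> table_generated (t, gens) -> table_hom t f' ->
    {in gens, forall g, f' g \in H} ->
    (forall K : {group rT}, {in gens, forall g, f' g \in K} -> H \subset K) ->
  H \homg G.
Proof.
move=> mf gen_t hom_f' Hgens genH; have [phi phiE] := model_morphism mf hom_f'.
apply/homgP; exists phi; apply/eqP; rewrite eqEsubset; apply/andP; split.
  apply/subsetP=> _ /morphimP[x _ Gx ->]; have [i lti <-] := (model_im mf x).1 Gx.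
  by rewrite phiE // (generated_ind hom_f' gen_t Hgens).
apply: (genH (phi @* G)%G) => g gens_g /=; have /andP[/allP lt_gens _] := gen_t.
have ltg := lt_gens g gens_g; have Gg := mem_model mf ltg.
by rewrite -(phiE g ltg); apply: mem_morphim.
Qed.

Lemma size_cyc n : size (cyc n) = n.
Proof. exact: size_mkseq. Qed.

Lemma cyc_hom (gT : finGroupType) n (a : gT) :
  0 < n -> a ^+ n = 1 -> table_hom (cyc n) (fun i => a ^+ i).
Proof.
move=> n_gt0 an; split=> // i j; rewrite size_mkseq => lti ltj.
rewrite /mult !nth_mkseq // ltn_mod n_gt0; split=> //.
by rewrite expg_mod // expgD.
Qed.

Lemma metacyc_hom (gT : finGroupType) n c p h (a b : gT) :
    h < n -> a ^+ n = 1 -> a ^ b = a ^+ c -> b ^+ p = a ^+ h -> 0 < p ->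
  table_hom (metacyc n c p h) (fun i => b ^+ (i %/ n) * a ^+ (i %% n)).
Proof.
move=> lt_hn an ab bp p_gt0; have n_gt0 : 0 < n by apply: leq_ltn_trans lt_hn.
have := @ext_hom _ (cyc n) (fun i => a ^+ i) p (mult_by n c) h b (cyc_hom n_gt0 an).
rewrite size_mkseq; apply=> // u ltu; rewrite nth_mkseq ?ltn_mod //.
by rewrite expg_mod // expgM -ab conjXg.
Qed.

Lemma by_cyc_hom (gT : finGroupType) t p (f : nat -> gT) x :
    table_hom t f -> 0 < size t -> {in gtn (size t), forall u, commute (f u) x} ->
    x ^+ p = 1 -> 0 < p ->
  table_hom (by_cyc t p) (fun i => x ^+ (i %/ size t) * f (i %% size t)).
Proof.
move=> hom_f t_gt0 cfx xp p_gt0.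
apply: ext_hom => // [u ltu|u ltu|]; rewrite ?nth_iota //.
  by apply/esym/conjg_fixP/commgP/cfx.
by rewrite xp (table_hom1 hom_f).
Qed.

Section TableRelations.

Variables (gT : finGroupType) (t : table) (f : nat -> gT).
Hypothesis hom_f : table_hom t f.

Lemma table_exp i k j : i < size t -> iter k (mult t i) 0 = j -> f i ^+ k = f j.
Proof.
have [f1 fM] := hom_f => lti <-.
suffices [_ ->] : iter k (mult t i) 0 < size t /\ f i ^+ k = f (iter k (mult t i) 0) by [].
elim: k => [|k [ltk Ek]] /=; first by rewrite f1 (leq_trans _ lti).
by have [lt_ik ->] := fM _ _ lti ltk; rewrite expgS Ek.
Qed.

Lemma table_conj i j k : i < size t -> j < size t -> k < size t ->
  mult t i j = mult t j k -> f i ^ f j = f k.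
Proof.
have [_ fM] := hom_f => lti ltj ltk Eij; apply: (mulgI (f j)); rewrite -conjgC.
by have [_ <-] := fM _ _ lti ltj; have [_ <-] := fM _ _ ltj ltk; rewrite Eij.
Qed.

Lemma table_inverse i k : i < size t -> k < size t -> mult t i k = 0 -> (f i)^-1 = f k.
Proof.
have [f1 fM] := hom_f => lti ltk Eik; apply: (mulgI (f i)); rewrite mulgV.
by have [_ <-] := fM _ _ lti ltk; rewrite Eik f1.
Qed.

Lemma table_commg i j : i < size t -> j < size t -> mult t i j = mult t j i ->
  [~ f i, f j] = 1.
Proof.
have [_ fM] := hom_f => lti ltj Eij; apply/eqP/commgP; rewrite /commute.
by have [_ <-] := fM _ _ lti ltj; have [_ <-] := fM _ _ ltj lti; rewrite Eij.
Qed.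

End TableRelations.

Lemma generated_eq (gT : finGroupType) (G H : {group gT}) t f gens :
    model G t f -> table_generated (t, gens) -> {in gens, forall g, f g \in H} ->
    (forall K : {group gT}, {in gens, forall g, f g \in K} -> H \subset K) ->
  H :=: G.
Proof.
move=> mf gen_t Hgens genH; apply/eqP; rewrite eqEsubset; apply/andP; split.
  have /andP[/allP lt_gens _] := gen_t; apply: genH => g /lt_gens; exact: (mem_model mf).
apply/subsetP=> x /(model_im mf)[i lti <-].
exact: generated_ind (model_hom mf) gen_t Hgens _ lti.
Qed.

(** The order of a presented group is never computed: the table realised as a group has the same
    presentation, hence is isomorphic to G. *)
Lemma modelled_isoGrp p t (ht : group_table t) (gT : finGroupType) (G : {group gT}) :
    (forall (rT : finGroupType) (H : {group rT}), modelled H t -> H \isog Grp p) ->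
  G \isog Grp p -> modelled G t.
Proof.
move=> isoGp isoG; have mT := table_group_modelled ht.
have isoT := isoGp _ [set: table_group ht]%G mT.
apply: isog_modelled mT; rewrite isogEhom isoT isoG.
by rewrite (isoGrp_hom isoG) (isoGrp_hom isoT).
Qed.

Lemma join2_sub (gT : finGroupType) (a b : gT) (K : {group gT}) :
  (<[a]> <*> <[b]> \subset K) = (a \in K) && (b \in K).
Proof. by rewrite join_subG !cycle_subG. Qed.

Lemma mem_join2 (gT : finGroupType) (a b : gT) :
  (a \in <[a]> <*> <[b]>) && (b \in <[a]> <*> <[b]>).
Proof. by rewrite -join2_sub. Qed.

Lemma table_generated_join2 (gT : finGroupType) (G : {group gT}) t f i j :
  model G t f -> table_generated (t, [:: i; j]) -> <[f i]> <*> <[f j]> = G.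
Proof.
move=> mf gen_t; have /andP[Hi Hj] := mem_join2 (f i) (f j).
apply: (@generated_eq _ G (<[f i]> <*> <[f j]>)%G _ _ _ mf gen_t) => [g | K genK].
  by rewrite !inE => /orP[] /eqP->.
by rewrite /= join2_sub !genK ?inE ?eqxx ?orbT.
Qed.

Lemma join3_sub (gT : finGroupType) (a b c : gT) (K : {group gT}) :
  (<[a]> <*> <[b]> <*> <[c]> \subset K) = [&& a \in K, b \in K & c \in K].
Proof. by rewrite join_subG join2_sub cycle_subG andbA. Qed.

Lemma mem_join3 (gT : finGroupType) (a b c : gT) (J := <[a]> <*> <[b]> <*> <[c]>) :
  [&& a \in J, b \in J & c \in J].
Proof. by rewrite -join3_sub. Qed.

Lemma table_generated_join3 (gT : finGroupType) (G : {group gT}) t f i j k :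
    model G t f -> table_generated (t, [:: i; j; k]) ->
  <[f i]> <*> <[f j]> <*> <[f k]> = G.
Proof.
move=> mf gen_t; have /and3P[Hi Hj Hk] := mem_join3 (f i) (f j) (f k).
apply: (@generated_eq _ G (<[f i]> <*> <[f j]> <*> <[f k]>)%G _ _ _ mf gen_t) => [g | K genK].
  by rewrite !inE => /or3P[] /eqP->.
by rewrite /= join3_sub !genK ?inE ?eqxx ?orbT.
Qed.

Lemma metacyc_homg (gT rT : finGroupType) (G : {group gT}) (H : {group rT}) n c p h (a b : rT) :
    modelled G (metacyc n c p h) -> table_generated (metacyc n c p h, [:: 1; n])%N ->
    1 < n -> h < n -> 0 < p -> <[a]> <*> <[b]> = H ->
    a ^+ n = 1 -> a ^ b = a ^+ c -> b ^+ p = a ^+ h ->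
  H \homg G.
Proof.
move=> [f mf] gen_t n_gt1 lt_hn p_gt0 defH an ab bp; have n_gt0 := ltnW n_gt1.
have hom := metacyc_hom lt_hn an ab bp p_gt0; have /andP[Ha Hb] := mem_join2 a b.
have Ea : b ^+ (1 %/ n) * a ^+ (1 %% n) = a by rewrite divn_small // modn_small // mul1g.
have Eb : b ^+ (n %/ n) * a ^+ (n %% n) = b by rewrite divnn n_gt0 modnn mulg1.
apply: (table_homg mf gen_t hom) => [g | K genK].
  by rewrite !inE -defH => /orP[] /eqP->; rewrite ?Ea ?Eb.
rewrite -defH join2_sub -{1}Ea -{2}Eb.
by rewrite !genK ?inE ?eqxx ?orbT.
Qed.

(** * The five presentations *)

Lemma generated_tQ12 : table_generated (tQ12, [:: 1; 6])%N.
Proof. by vm_compute. Qed.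

Lemma tQ12_isQ12 (gT : finGroupType) (G : {group gT}) : modelled G tQ12 -> isQ12 G.
Proof.
move=> mG.
apply: intro_isoGrp => [|rT H].
  have [f mf] := mG; have hf := model_hom mf; have f1 := table_hom1 hf.
  apply/existsP; exists (f 1, f 6)%N => /=; rewrite (table_generated_join2 mf generated_tQ12).
  have -> : f 1%N ^+ 6 = f 0 by apply: (table_exp hf).
  have -> : f 6 ^+ 2 = f 3 by apply: (table_exp hf).
  have -> : f 1%N ^+ 3 = f 3 by apply: (table_exp hf).
  have -> : (f 1%N)^-1 = f 5 by apply: (table_inverse hf).
  have -> : f 1%N ^ f 6 = f 5 by apply: (table_conj hf).
  by rewrite f1.
case/existsP=> -[a b] /= /eqP[defH a6 b2 ab].
(* [metacyc] encodes conjugation by an exponent, so the inverse of a is rewritten as a positive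
   power. *)
have ab' : a ^ b = a ^+ 5 by rewrite ab; apply: (mulgI a); rewrite mulgV -expgS.
exact: (@metacyc_homg _ _ G H 6 5 2 3 a b mG generated_tQ12 isT isT isT defH a6 ab' b2).
Qed.

Lemma generated_tQ16 : table_generated (tQ16, [:: 1; 8])%N.
Proof. by vm_compute. Qed.

Lemma tQ16_isQ16 (gT : finGroupType) (G : {group gT}) : modelled G tQ16 -> isQ16 G.
Proof.
move=> mG.
apply: intro_isoGrp => [|rT H].
  have [f mf] := mG; have hf := model_hom mf; have f1 := table_hom1 hf.
  apply/existsP; exists (f 1, f 8)%N => /=; rewrite (table_generated_join2 mf generated_tQ16).
  have -> : f 1%N ^+ 8 = f 0 by apply: (table_exp hf).
  have -> : f 8 ^+ 2 = f 4 by apply: (table_exp hf).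
  have -> : f 1%N ^+ 4 = f 4 by apply: (table_exp hf).
  have -> : (f 1%N)^-1 = f 7 by apply: (table_inverse hf).
  have -> : f 1%N ^ f 8 = f 7 by apply: (table_conj hf).
  by rewrite f1.
case/existsP=> -[a b] /= /eqP[defH a8 b2 ab].
have ab' : a ^ b = a ^+ 7 by rewrite ab; apply: (mulgI a); rewrite mulgV -expgS.
exact: (@metacyc_homg _ _ G H 8 7 2 4 a b mG generated_tQ16 isT isT isT defH a8 ab' b2).
Qed.

Lemma generated_tM16 : table_generated (tM16, [:: 1; 8])%N.
Proof. by vm_compute. Qed.

Lemma tM16_isG16_6 (gT : finGroupType) (G : {group gT}) : modelled G tM16 -> isG16_6 G.
Proof.
move=> mG.
apply: intro_isoGrp => [|rT H].
  have [f mf] := mG; have hf := model_hom mf; have f1 := table_hom1 hf.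
  apply/existsP; exists (f 1, f 8)%N => /=; rewrite (table_generated_join2 mf generated_tM16).
  have -> : f 1%N ^+ 8 = f 0 by apply: (table_exp hf).
  have -> : f 8 ^+ 2 = f 0 by apply: (table_exp hf).
  have -> : f 1%N ^+ 5 = f 5 by apply: (table_exp hf).
  have -> : f 1%N ^ f 8 = f 5 by apply: (table_conj hf).
  by rewrite f1.
case/existsP=> -[a b] /= /eqP[defH a8 b2 ab].
exact: (@metacyc_homg _ _ G H 8 5 2 0 a b mG generated_tM16 isT isT isT defH a8 ab b2).
Qed.

Lemma generated_tC6xC3 : table_generated (tC6xC3, [:: 1; 6])%N.
Proof. by vm_compute. Qed.

Lemma tC6xC3_isZ6xZ3 (gT : finGroupType) (G : {group gT}) : modelled G tC6xC3 -> isZ6xZ3 G.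
Proof.
move=> mG.
apply: intro_isoGrp => [|rT H].
  have [f mf] := mG; have hf := model_hom mf; have f1 := table_hom1 hf.
  apply/existsP; exists (f 1, f 6)%N => /=; rewrite (table_generated_join2 mf generated_tC6xC3).
  have -> : f 1%N ^+ 6 = f 0 by apply: (table_exp hf).
  have -> : f 6 ^+ 3 = f 0 by apply: (table_exp hf).
  have -> : [~ f 1%N, f 6] = 1 by apply: (table_commg hf).
  by rewrite f1.
case/existsP=> -[a b] /= /eqP[defH a6 b3 ab]; have [f mf] := mG.
have cab u : commute (a ^+ u) b by apply/commute_sym/commuteX/commute_sym/commgP/eqP.
have := @by_cyc_hom _ _ 3 _ b (cyc_hom (isT : 0 < 6) a6) isT (fun u _ => cab u) b3 isT.
rewrite size_cyc -/tC6xC3 => hom.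
have Ea : b ^+ (1 %/ 6) * a ^+ (1 %% 6) = a by rewrite -[LHS]/(1 * a) mul1g.
have Eb : b ^+ (6 %/ 6) * a ^+ (6 %% 6) = b by rewrite -[LHS]/(b * 1) mulg1.
have /andP[Ha Hb] := mem_join2 a b.
apply: (table_homg mf generated_tC6xC3 hom) => [g | K genK].
  by rewrite !inE -defH => /orP[] /eqP->; rewrite ?Ea ?Eb.
by rewrite -defH join2_sub -{1}Ea -{2}Eb !genK ?inE.
Qed.

Lemma generated_tD8oC4 : table_generated (tD8oC4, [:: 1; 4; 8])%N.
Proof. by vm_compute. Qed.

Lemma tD8oC4_isG16_13 (gT : finGroupType) (G : {group gT}) : modelled G tD8oC4 -> isG16_13 G.
Proof.
move=> mG.
have [f mf] := mG; apply: intro_isoGrp => [|rT H].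
  have hf := model_hom mf; have f1 := table_hom1 hf.
  apply/existsP; exists (f 1, f 4, f 8)%N => /=.
  have -> : <[f 1%N]> <*> <[f 4]> <*> <[f 8]> = G.
    exact: (table_generated_join3 mf generated_tD8oC4).
  have -> : f 1%N ^+ 4 = f 0 by apply: (table_exp hf).
  have -> : f 4 ^+ 2 = f 0 by apply: (table_exp hf).
  have -> : f 8 ^+ 2 = f 0 by apply: (table_exp hf).
  have -> : [~ f 1%N, f 4] = 1 by apply: (table_commg hf).
  have -> : [~ f 1%N, f 8] = 1 by apply: (table_commg hf).
  have -> : f 1%N ^+ 2 = f 2 by apply: (table_exp hf).
  have -> : f 4 ^ f 8 = f 6 by apply: (table_conj hf).
  have -> : f 2 * f 4 = f 6 by have [_ <-] := table_homM hf (isT : 2 < 16) (isT : 4 < 16).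
  by rewrite f1.
case/existsP=> -[[a b] c] /= /eqP[defH a4 b2 c2 ab ac bc].
have cab : commute a b by apply/commgP/eqP.
have cac : commute a c by apply/commgP/eqP.
pose f1 i := b ^+ (i %/ 4) * a ^+ (i %% 4).
have cabX u : commute (a ^+ u) b by apply/commute_sym/commuteX/commute_sym.
have hom1 : table_hom tC4xC2 f1.
  have := @by_cyc_hom _ _ 2 _ b (cyc_hom (isT : 0 < 4) a4) isT (fun u _ => cabX u) b2 isT.
  by rewrite size_cyc.
have aXc k : (a ^+ k) ^ c = a ^+ k.
  by apply/conjg_fixP/commgP/commute_sym/commuteX/commute_sym.
have bXc k : (b * a ^+ k) ^ c = b * a ^+ (k + 2).
  by rewrite conjMg aXc bc (cabX 2) -mulgA -expgD addnC.
(* Index 4 l + k stands for b^l a^k. Conjugation by c fixes each a^k and sends b a^k to b a^(k + 2),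
   which exchanges 4 with 6 and 5 with 7. *)
pose sig := [:: 0; 1; 2; 3; 6; 7; 4; 5]%N; have sz : size tC4xC2 = 8 by [].
have sig_lt : {in gtn (size tC4xC2), forall u, nth 0 sig u < size tC4xC2}.
  by rewrite sz => u; rewrite inE; do 8! case: u => [|u] //.
have sigE : {in gtn (size tC4xC2), forall u, f1 (nth 0 sig u) = f1 u ^ c}.
  rewrite sz => u; rewrite inE => ltu; rewrite /f1.
  have [lt4 | ge4] := ltnP u 4.
    have -> : b ^+ (u %/ 4) * a ^+ (u %% 4) = a ^+ u.
      by rewrite divn_small // modn_small // mul1g.
    rewrite aXc; case: u lt4 {ltu} => [|[|[|[|u]]]] // _; exact: mul1g.
  (* In the upper half u = 4 + v stands for b a^v, and the exponent v + 2 is reduced by a^4 = 1. *)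
  have -> : u = (1 * 4 + (u - 4))%N by rewrite subnKC.
  have {ge4 ltu} : u - 4 < 4 by rewrite ltn_subLR.
  move: (u - 4)%N => v ltv.
  have -> : b ^+ ((1 * 4 + v) %/ 4) * a ^+ ((1 * 4 + v) %% 4) = b * a ^+ v.
    by rewrite divnMDl // divn_small // modnMDl modn_small.
  have a4D k : a ^+ (4 + k) = a ^+ k by rewrite expgD a4 mul1g.
  rewrite bXc; case: v ltv => [|[|[|[|v]]]] // _.
    by rewrite (a4D 0).
  by rewrite (a4D 1%N).
have c2' : c ^+ 2 = f1 0 by rewrite c2 -[RHS]/(1 * 1) mulg1.
have := @ext_hom _ tC4xC2 f1 2 sig 0 c hom1 isT sig_lt sigE c2' isT.
rewrite sz -/tD8oC4 => hom.
have /and3P[Ha Hb Hc] := mem_join3 a b c.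
have Ea : c ^+ (1 %/ 8) * f1 (1 %% 8) = a by rewrite -[LHS]/(1 * (1 * a)) !mul1g.
have Eb : c ^+ (4 %/ 8) * f1 (4 %% 8) = b by rewrite -[LHS]/(1 * (b * 1)) mul1g mulg1.
have Ec : c ^+ (8 %/ 8) * f1 (8 %% 8) = c by rewrite -[LHS]/(c * (1 * 1)) !mulg1.
apply: (table_homg mf generated_tD8oC4 hom) => [g | K genK].
  by rewrite !inE -defH => /or3P[] /eqP->; rewrite ?Ea ?Eb ?Ec.
have Ka : a \in K by rewrite -Ea genK ?inE.
have Kb : b \in K by rewrite -Eb genK ?inE.
have Kc : c \in K by rewrite -Ec genK ?inE.
by rewrite -defH join3_sub Ka Kb Kc.
Qed.

Local Close Scope group_scope.

(** * The symmetric and alternating groups of degree 4 *)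

Definition perms4 := [seq s <- tuples (nseq 4 (iota 0 4)) | uniq s].

Definition comp4 (s1 s2 : seq nat) := [seq nth 0 s2 (nth 0 s1 i) | i <- iota 0 4].

(** [tuples] enumerates lexicographically, so the identity gets index 0. [comp4] applies its first
    argument first, as the product of permutations does. *)
Definition tS4 : table := [seq [seq index (comp4 s1 s2) perms4 | s2 <- perms4] | s1 <- perms4].

Local Open Scope group_scope.

Definition perm_seq (x : {perm 'I_4}) : seq nat := [seq val (x i) | i <- enum 'I_4].

Lemma nth_perm_seq x (i : 'I_4) : nth 0 (perm_seq x) i = x i.
Proof. by rewrite (nth_map i) ?size_enum_ord ?nth_ord_enum. Qed.

Lemma perm_seq_inj : injective perm_seq.
Proof.
by move=> x y Exy; apply/permP=> i; apply: val_inj; rewrite /= -!nth_perm_seq Exy.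
Qed.

Lemma perm_seqM x y : perm_seq (x * y) = comp4 (perm_seq x) (perm_seq y).
Proof.
rewrite /comp4 -val_enum_ord -map_comp; apply: eq_map => i /=.
by rewrite permM !nth_perm_seq.
Qed.

Lemma mem_perms4 x : perm_seq x \in perms4.
Proof.
rewrite mem_filter map_inj_uniq ?enum_uniq; last by move=> i j /val_inj/perm_inj.
have {1}-> : 4 = size (perm_seq x) by rewrite size_map size_enum_ord.
by apply: mem_tuples; apply/allP=> _ /mapP[i _ ->] /=; apply: ltn_ord.
Qed.

(** By counting: [perm_seq] is injective and both sides have 24 elements. *)
Lemma perm_seq_onto s : s \in perms4 -> exists x, perm_seq x = s.
Proof.
have u : uniq (map perm_seq (enum {perm 'I_4})).
  by rewrite map_inj_uniq ?enum_uniq //; apply: perm_seq_inj.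
have sub : {subset map perm_seq (enum {perm 'I_4}) <= perms4}.
  by move=> _ /mapP[x _ ->]; apply: mem_perms4.
have [|_ eq_s] := uniq_min_size u sub.
  by rewrite size_map -cardE -cardsT -[[set: _]]/('Sym_('I_4)) card_Sym card_ord.
by rewrite -eq_s => /mapP[x _ ->]; exists x.
Qed.

Lemma Sym4_modelled : modelled 'Sym_('I_4) tS4.
Proof.
have sz : size tS4 = size perms4 by rewrite size_map.
pose f i := odflt 1 [pick x | perm_seq x == nth [::] perms4 i].
have fE i : i < size perms4 -> perm_seq (f i) = nth [::] perms4 i.
  move=> lti; rewrite /f; case: pickP => [x /eqP // | no_x].
  by have [x /eqP] := perm_seq_onto (mem_nth [::] lti); rewrite no_x.
have u4 : uniq perms4 by [].
exists f; split=> [||i j|x].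
- split=> [|i j].
    apply: perm_seq_inj; rewrite fE //; apply: (@eq_from_nth _ 0).
      by rewrite size_map size_enum_ord.
    move=> i lti; rewrite -[i]/(nat_of_ord (Ordinal (lti : i < 4))) nth_perm_seq perm1.
    by do 4! case: i lti => [|i] lti //.
  rewrite sz => lti ltj; have Eij : mult tS4 i j = index (perm_seq (f i * f j)) perms4.
    by rewrite /mult (nth_map [::]) // (nth_map [::]) // perm_seqM !fE.
  have lt_ij : mult tS4 i j < size perms4 by rewrite Eij index_mem mem_perms4.
  by split=> //; apply: perm_seq_inj; rewrite fE // Eij nth_index ?mem_perms4.
- by apply/allP=> _ /mapP[s _ ->]; rewrite sz size_map.
- rewrite !inE sz => lti ltj /(congr1 perm_seq); rewrite !fE // => /eqP.
  by rewrite nth_uniq // => /eqP.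
rewrite inE; split=> // _; exists (index (perm_seq x) perms4).
  by rewrite sz index_mem mem_perms4.
by apply: perm_seq_inj; rewrite fE ?index_mem ?nth_index ?mem_perms4.
Qed.

Lemma Sym4_no_order6 (x : {perm 'I_4}) : x ^+ 6 = 1 -> (x ^+ 2 == 1) || (x ^+ 3 == 1).
Proof.
have [f mf] := Sym4_modelled; have hf := model_hom mf; have f1 := table_hom1 hf.
have [i lti <-] := (model_im mf x).1 (in_setT x).
have ok : all (fun i => [|| iter 6 (mult tS4 i) 0 != 0, iter 2 (mult tS4 i) 0 == 0 |
                            iter 3 (mult tS4 i) 0 == 0]) (iota 0 (size tS4)) by vm_compute.
have lt_iter k : iter k (mult tS4 i) 0 < size tS4.
  by elim: k => //= k IHk; apply: (model_mult_lt mf).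
rewrite !(table_exp hf lti erefl) -f1 => /(model_inj mf (lt_iter 6) (isT : 0 < 24)) E6.
have: i \in iota 0 (size tS4) by rewrite mem_iota.
by move/(allP ok); rewrite E6 eqxx orFb => /orP[] /eqP->; rewrite eqxx ?orbT.
Qed.

(** Every other group of order 12 has an element of order 6, and the symmetric group of degree 4 has
    none. *)
Lemma Alt4_modelled : modelled 'Alt_('I_4) tA4.
Proof.
have oA : #|'Alt_('I_4)| = 12 by apply: double_inj; rewrite -mul2n card_Alt card_ord.
have [|tg] := @small_groups _ 'Alt_('I_4)%G; first by rewrite /= oA.
rewrite /= oA => reps_tg [f mf]; have hf := model_hom mf; have f1 := table_hom1 hf.
have ok : all (fun tg : table * seq nat => (tg.1 == tA4) ||
    has (fun i => [&& iter 6 (mult tg.1 i) 0 == 0, iter 2 (mult tg.1 i) 0 != 0 &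
                      iter 3 (mult tg.1 i) 0 != 0]) (iota 0 (size tg.1))) (reps 12).
  by vm_compute.
have /orP[/eqP <- | /hasP[i]] := allP ok _ reps_tg; first by exists f.
rewrite mem_iota => lti /and3P[/eqP E6 n2 n3]; have t_gt0 := model_size_gt0 mf.
have lt_iter k : iter k (mult tg.1 i) 0 < size tg.1.
  by elim: k => //= k IHk; apply: (model_mult_lt mf).
have := @Sym4_no_order6 (f i); rewrite !(table_exp hf lti erefl) E6 f1 => /(_ erefl).
rewrite -f1 => /orP[] /eqP/(model_inj mf (lt_iter _) t_gt0)/eqP E.
  by rewrite E in n2.
by rewrite E in n3.
Qed.

(** * The theorem *)

Lemma modelled_isog (gT rT : finGroupType) (G : {group gT}) (H : {group rT}) t :
  modelled G t -> modelled H t -> G \isog H.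
Proof.
move=> [f mf] [f' mf']; have [phi phiE] := model_morphism mf (model_hom mf').
apply/isogP; exists phi.
  apply/injmP=> _ _ /(model_im mf)[i lti <-] /(model_im mf)[j ltj <-].
  by rewrite !phiE // => /(model_inj mf' lti ltj)->.
apply/setP=> y; apply/morphimP/idP => [[_ _ /(model_im mf)[i lti <-] ->] | Hy].
  by rewrite phiE // (mem_model mf').
have [i lti <-] := (model_im mf' y).1 Hy; have Gi := mem_model mf lti.
by exists (f i); rewrite ?phiE.
Qed.

Lemma cyclic_modelled (gT : finGroupType) (G : {group gT}) :
  cyclic G <-> modelled G (cyc #|G|).
Proof.
split=> [/cyclicP[x defG] | [f mf]].
  have ox : #[x] = #|G| by rewrite defG.
  exists (fun i => x ^+ i); split=> [||i j|y].
  - by apply: cyc_hom; rewrite ?cardG_gt0 // -ox expg_order.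
  - exact: square_mkseq.
  - rewrite !inE size_cyc -ox => lti ltj /eqP.
    by rewrite eq_expg_mod_order !modn_small // => /eqP.
  rewrite size_cyc -ox {1}defG; split=> [/cyclePmin[i lti ->] | [i _ <-]].
    by exists i.
  exact: mem_cycle.
have [f1 fM] := model_hom mf; rewrite size_cyc in fM; set n := #|G| in mf fM *.
apply/cyclicP; exists (f (1 %% n)%N); apply/eqP; rewrite eqEsubset cycle_subG.
rewrite (mem_model mf) ?size_cyc ?ltn_mod ?cardG_gt0 // andbT.
apply/subsetP=> x /(model_im mf)[i]; rewrite size_cyc => lti <-.
apply/cycleP; exists i; elim: i lti => [|i IHi] lti; first by rewrite f1.
have n_gt1 : 1 < n by apply: leq_ltn_trans lti.
rewrite expgS -IHi ?(ltnW lti) //; have [_ <-] := fM (1 %% n)%N i (ltn_pmod _ (ltnW n_gt1)) (ltnW lti).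
by rewrite /mult !nth_mkseq ?(ltnW lti) ?ltn_mod ?(ltnW n_gt1) // (modn_small n_gt1) add1n modn_small.
Qed.

Local Open Scope nat_scope.

Definition T2_reps : seq table := [:: tA4; tQ12; tQ16; tM16; tD8oC4].

(** Entries are indices in a table. Which list belongs to which table is not recorded, since
    [T2_found] tries them all. *)
Definition T2_witnesses : seq (seq nat) := [::
  [:: 0; 9; 1; 3; 5; 11; 8; 4; 10; 7; 6; 2];
  [:: 0; 1; 9; 5; 2; 7; 11; 10; 6; 4; 8; 3];
  [:: 0; 9; 12; 2; 13; 15; 5; 14; 11; 10; 6; 8; 1; 7; 3; 4];
  [:: 0; 9; 15; 11; 12; 7; 2; 14; 3; 13; 1; 6; 5; 8; 10; 4];
  [:: 0; 9; 1; 4; 10; 8; 13; 14; 6; 11; 5; 3; 7; 12; 15; 2];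
  [:: 0; 13; 17; 1; 11; 14; 10; 16; 12; 5; 15; 8; 2; 9; 6; 7; 4; 3];
  [:: 0; 13; 8; 7; 3; 4; 10; 17; 11; 15; 5; 2; 14; 16; 1; 9; 6; 12];
  [:: 0; 13; 17; 15; 11; 16; 1; 4; 10; 12; 14; 8; 5; 7; 9; 2; 6; 3];
  [:: 0; 13; 8; 3; 12; 9; 14; 1; 4; 16; 7; 6; 5; 17; 2; 15; 10; 11];
  [:: 0; 16; 8; 9; 2; 10; 5; 12; 19; 4; 15; 17; 3; 18; 14; 13; 11; 7; 1; 6];
  [:: 0; 16; 8; 9; 2; 18; 1; 10; 15; 7; 11; 17; 14; 12; 6; 19; 13; 4; 3; 5];
  [:: 0; 16; 8; 9; 2; 15; 6; 19; 4; 7; 14; 3; 17; 1; 5; 18; 11; 13; 12; 10];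
  [:: 0; 17; 5; 13; 10; 2; 9; 7; 1; 16; 4; 3; 14; 15; 11; 19; 12; 8; 18; 20; 6];
  [:: 0; 19; 11; 16; 13; 14; 1; 7; 17; 6; 21; 20; 2; 4; 8; 12; 9; 5; 3; 15; 10; 18];
  [:: 0; 18; 14; 12; 2; 22; 20; 5; 19; 9; 16; 3; 8; 10; 15; 7; 23; 13; 6; 17; 21; 1; 4; 11]].

(** For p = 2, 3, 5, 7, 11, 13, 17, 19 the entries are the discrete logarithms of 1, ..., p - 1
    modulo p, to a primitive root such as 3 modulo 7 or 14 modulo 19. The difference log (i + m) -
    log i = log (1 + m / i) determines i, so the differences at each distance m are distinct. *)
Definition T3_witnesses : seq (seq nat) := [::
  [:: 0]; [:: 0; 1]; [:: 0; 1; 3; 2]; [:: 0; 2; 1; 4; 5; 3];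
  [:: 0; 3; 4; 6; 2; 7; 1; 9; 8; 5]; [:: 0; 1; 4; 2; 9; 5; 11; 3; 8; 10; 7; 6];
  [:: 0; 2; 7; 4; 3; 9; 13; 6; 14; 5; 1; 11; 12; 15; 10; 8];
  [:: 0; 13; 7; 8; 10; 2; 6; 3; 14; 5; 12; 15; 11; 1; 17; 16; 4; 9]].

Definition T2_found t := has (table_terrace 2 t) T2_witnesses.

Lemma modelled_T2_found (gT : finGroupType) (G : {group gT}) t :
  modelled G t -> T2_found t -> has_directed_terrace 2 G.
Proof. by move=> [f mf] /hasP[s _ ts]; apply: has_terrace_of_table mf _ _ ts. Qed.

Lemma T2_found_reps : all T2_found [:: tS4, tC6xC3 & T2_reps].
Proof. by vm_compute. Qed.

Lemma reps_lt18 : all (fun n => all (fun tg : table * seq nat =>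
  [|| table_comm tg.1, tg \in no_T2_reps | tg.1 \in T2_reps]) (reps n)) (iota 1 17).
Proof. by vm_compute. Qed.

Lemma reps_ge18 : all (fun n => all (fun tg : table * seq nat =>
  table_comm tg.1 || T2_found tg.1) (reps n)) (iota 18 5).
Proof. by vm_compute. Qed.

Lemma reps_lt20 : all (fun n => all (fun tg : table * seq nat =>
  [|| (tg.1 == cyc n) && prime n.+1,
      [&& table_comm tg.1, table_prod tg.1 == 0 & 1 < size tg.1],
      tg \in no_T2_reps | tg \in no_T3_reps]) (reps n)) (iota 1 19).
Proof. by vm_compute. Qed.

Lemma T3_found_cyc : all (fun n => if prime n.+1 then has (table_terrace 3 (cyc n)) T3_witnesses
                                   else true) (iota 1 19).
Proof. by vm_compute. Qed.

Local Open Scope group_scope.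

Lemma T2_cases (gT : finGroupType) (G : {group gT}) t : modelled G t -> t \in T2_reps ->
  (G \isog 'Alt_('I_4)) \/ isQ12 G \/ isQ16 G \/ isG16_6 G \/ isG16_13 G.
Proof.
move=> mG; rewrite !inE => /or4P[||| /orP[]] /eqP Et; rewrite Et in mG.
- by left; apply: modelled_isog mG Alt4_modelled.
- by right; left; apply: tQ12_isQ12.
- by do 2 right; left; apply: tQ16_isQ16.
- by do 3 right; left; apply: tM16_isG16_6.
by do 4 right; apply: tD8oC4_isG16_13.
Qed.

Theorem theorem9 :
  (forall (gT : finGroupType) (G : {group gT}),
      ~~ abelian G -> (#|G| <= 22)%N ->
      (has_directed_terrace 2 G <->
         (G \isog 'Alt_('I_4)) \/ isQ12 G \/ isQ16 G \/ isG16_6 G \/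
         isG16_13 G \/ (18 <= #|G|)%N))
  /\ (forall (gT : finGroupType) (G : {group gT}),
        isZ6xZ3 G -> has_directed_terrace 2 G)
  /\ has_directed_terrace 2 ('Sym_('I_4))
  /\ (forall (gT : finGroupType) (G : {group gT}),
        (#|G| < 20)%N ->
        (has_directed_terrace 3 G <-> cyclic G /\ prime #|G|.+1)).
Proof.
have found t : t \in [:: tS4, tC6xC3 & T2_reps] ->
    forall (gT : finGroupType) (G : {group gT}), modelled G t -> has_directed_terrace 2 G.
  by move=> /(allP T2_found_reps) Ht gT G mG; apply: modelled_T2_found mG Ht.
split; last split; last split; last first.
- move=> gT G lt20; have n_range : #|G| \in iota 1 19 by rewrite mem_iota cardG_gt0.
  split=> [tG | [/cyclic_modelled mG p_pr]]; last first.
    have := allP T3_found_cyc _ n_range; rewrite p_pr => /hasP[s _ ts].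
    by have [f mf] := mG; apply: has_terrace_of_table mf _ _ ts.
  have [|tg reps_tg mG] := @small_groups _ G; first by rewrite ltnW // (leq_trans lt20).
  have /or4P[/andP[/eqP Et p_pr] | /and3P[cG /eqP prod0 n_gt1] | no2 | no3] :=
    allP (allP reps_lt20 _ n_range) _ reps_tg.
  - by split=> //; apply/cyclic_modelled; rewrite -Et.
  - by have [f mf] := mG; case: (abelian_prod1_no_terrace mf (isT : 0 < 3) cG prod0 n_gt1 tG).
  (* A directed T_3-terrace is also a directed T_2-terrace, so the search at k = 2 settles this
     group. *)
  - by case: (modelled_no_T2 mG no2); apply: terrace_le tG.
  by case: (modelled_no_T3 mG no3).
- exact: (found tS4 _ _ 'Sym_('I_4)%G Sym4_modelled).
- move=> gT G isoG; apply: (found tC6xC3) => //.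
  apply: (modelled_isoGrp (t := tC6xC3) _ _ isoG) => [|rT H]; first by vm_compute.
  exact: tC6xC3_isZ6xZ3.
move=> gT G nabG le22; have [tg reps_tg mG] := small_groups le22.
have nab_t : ~~ table_comm tg.1 by have [f mf] := mG; rewrite (model_abelian mf).
split=> [tG | ].
  have [ge18 | lt18] := leqP 18 #|G|; first by do 5 right.
  have n_range : #|G| \in iota 1 17 by rewrite mem_iota cardG_gt0.
  have := allP (allP reps_lt18 _ n_range) _ reps_tg; rewrite (negPf nab_t) /=.
  case/orP=> [no2 | T2]; first by case: (modelled_no_T2 mG no2).
  by have [|[|[|[]]]] := T2_cases mG T2; [left | right; left | do 2 right; left |
    do 3 right; left | do 4 right; left].
case=> [isoA | [iso | [iso | [iso | [iso | ge18]]]]].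
- by apply: (found tA4) => //; apply: isog_modelled isoA Alt4_modelled.
- apply: (found tQ12) => //.
  by apply: (modelled_isoGrp (t := tQ12) _ _ iso) => [|rT H]; [vm_compute | apply: tQ12_isQ12].
- apply: (found tQ16) => //.
  by apply: (modelled_isoGrp (t := tQ16) _ _ iso) => [|rT H]; [vm_compute | apply: tQ16_isQ16].
- apply: (found tM16) => //.
  by apply: (modelled_isoGrp (t := tM16) _ _ iso) => [|rT H]; [vm_compute | apply: tM16_isG16_6].
- apply: (found tD8oC4) => //.
  by apply: (modelled_isoGrp (t := tD8oC4) _ _ iso) => [|rT H];
    [vm_compute | apply: tD8oC4_isG16_13].
have n_range : #|G| \in iota 18 5 by rewrite mem_iota ge18.
have := allP (allP reps_ge18 _ n_range) _ reps_tg; rewrite (negPf nab_t) /=.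
exact: modelled_T2_found.
Qed.
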